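(* Let $(Y_t)_{t\ge 0}$ be the locally-balanced Markov jump process (LBMJP) with balancing function $g$, base kernel $\gamma$ and target distribution $\pi$, with jump rate $\lambda$ and embedded chain $X=(X_n)_{n\ge 0}$ with transition kernel $\Gamma_g$, and let $L$ be its weak generator. Assume: (1) $\lambda(x)>0$ for all $x\in\mathrm{supp}(\pi)$; (2) $g$ is non-decreasing and continuous on $[0,\infty)$; (3) there is a non-trivial measure $\phi$ on $(E,\mathcal{E})$ such that for all $x\in\mathrm{supp}(\pi)$ and all $B\in\mathcal{E}$ with $\phi(B)>0$ there exists $n\in\mathbb{N}$ with $\mathbb{P}_x(X_n\in B)>0$; (4) for all $x\in\mathrm{supp}(\pi)$ and all $A\in\mathcal{E}$ with $\pi(A)=0$, $\Gamma_g(x,A)=0$. If $\gamma_L>0$ and $Y_0\sim\mu$ with $\mu\ll\pi$, then for all $t\geq 0$ $$\|\mu P_t-\pi\|_{TV}\le\tfrac12\,\chi^2(\mu\|\pi)^{1/2}\exp\{-\gamma_L t\}.$$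
   Context: Let $E$ be a Polish space with Borel $\sigma$-algebra $\mathcal{E}$, $\pi$ a probability measure on $(E,\mathcal{E})$ with topological support $\mathrm{supp}(\pi)$, and $\gamma:E\times\mathcal{E}\to[0,1]$ a Markov kernel. Write $[\pi\otimes\gamma](dx,dy)=\pi(dx)\gamma(x,dy)$. The function $t:E\times E\to[0,\infty)$ is a version of the Radon--Nikodym derivative $t(x,y)=\frac{\pi(dy)\gamma(y,dx)}{\pi(dx)\gamma(x,dy)}$ such that, for some measurable $R\subset E\times E$ with $[\pi\otimes\gamma](R)=1$, one has $0<t(x,y)<\infty$ and $t(y,x)=1/t(x,y)$ for $(x,y)\in R$, and $t(x,y)=0$ for $(x,y)\notin R$. A balancing function is a (Borel) function $g:[0,\infty)\to[0,\infty)$ with $g(1)=1$, $g(0)=0$, $g(s)>0$ for $s>0$, and $g(s)=s\,g(1/s)$ for all $s>0$. Jump rate: $\lambda(x)=\int_E g(t(x,y))\,\gamma(x,dy)\in[0,\infty]$. Embedded kernel: $\Gamma_g(x,A)=\int_A \frac{g(t(x,y))}{\lambda(x)}\,\gamma(x,dy)$ (at degenerate points, where $\lambda(x)\in\{0,\infty\}$, set $\Gamma_g(x,\cdot)=\delta_x$). LBMJP started from $x\in\mathrm{supp}(\pi)$: let $X=(X_n)_{n\ge0}$ be the discrete-time Markov chain with $X_0=x$ and transition kernel $\Gamma_g$; given $X$, let $\tau_n\sim\mathrm{Exp}(\lambda(X_{n-1}))$, $n\ge1$, be conditionally independent ($\mathrm{Exp}(0)$ means $+\infty$, $\mathrm{Exp}(\infty)$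 means $0$); set $T_0=0$, $T_n=\sum_{k=1}^n\tau_k$. Then $Y_t=X_{\sup\{n:T_n\le t\}}$ if $t<\sup_n T_n$, and $Y_t=\partial$ (a graveyard state) otherwise. $\mathbb{P}_x$ refers to the process started from $x$; $P_t(x,\cdot)=\mathbb{P}_x(Y_t\in\cdot)$ and $\mu P_t$ is the law of $Y_t$ when $Y_0\sim\mu$. Weak generator: for bounded $f$, $Lf(x)=\int_E g(t(x,y))(f(y)-f(x))\,\gamma(x,dy)$. Dirichlet form: $\mathcal{E}(L,f)=\langle f,-Lf\rangle_\pi=-\int_E f\,Lf\,d\pi$ for $f\in\mathcal{B}(E)$, the bounded measurable functions. Spectral gap: $\gamma_L=\inf_{f\in\mathcal{B}(E)}\mathcal{E}(L,f)/\mathrm{Var}_\pi(f)$ (infimum over $f$ with $\mathrm{Var}_\pi(f)>0$). $\chi^2(\mu\|\pi)=\int_E\left(\frac{d\mu}{d\pi}-1\right)^2d\pi$ (possibly $+\infty$), and $\|\mu-\nu\|_{TV}=\sup_{A\in\mathcal{E}}|\mu(A)-\nu(A)|$. *)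

(* Defs.v *)
From HB Require Import structures.
From mathcomp Require Import all_boot all_order all_algebra.
From mathcomp Require Import all_classical all_reals all_analysis measurable_realfun.

Set Implicit Arguments.
Unset Strict Implicit.
Unset Printing Implicit Defensive.

Import Order.TTheory GRing.Theory Num.Theory.
Import numFieldNormedType.Exports.

Local Open Scope classical_set_scope.
Local Open Scope ring_scope.

(* [borel E] is [E] itself, carrying the sigma-algebra generated by the open
   sets. *)
Notation borel E := (g_sigma_algebraType (@open E)).

(* The complete metric is not part of the structure of a Polish space, so it is
   existentially quantified. *)
Record complete_metric (R : realType) (E : topologicalType) (d : E -> E -> R)
    : Prop := CompleteMetric {
  dist_eq0 : forall x y, d x y = 0 <-> x = y ;
  dist_sym : forall x y, d x y = d y x ;
  dist_triangle : forall x y z, d x z <= d x y + d y z ;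
  dist_nbhs : forall x (A : set E),
    nbhs x A <-> exists2 e : R, 0 < e & [set y | d x y < e] `<=` A ;
  dist_complete : forall u : nat -> E,
    (forall e : R, 0 < e -> exists N : nat,
       forall m n, (N <= m)%N -> (N <= n)%N -> d (u m) (u n) < e) ->
    exists l : E, u @ \oo --> l }.

Definition polish (R : realType) (E : topologicalType) : Prop :=
  (exists2 D : set E, countable D & dense D) /\
  (exists d : E -> E -> R, complete_metric d).

Record balancing (R : realType) (g : R -> R) : Prop := Balancing {
  balancing_measurable : measurable_fun (`[0, +oo[ : set R) g ;
  balancing1 : g 1 = 1 ;
  balancing0 : g 0 = 0 ;
  balancing_gt0 : forall s, 0 < s -> 0 < g s ;
  balancing_inv : forall s, 0 < s -> g s = s * g (s^-1) }.

Section target_and_base_kernel.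
Context (R : realType) (E : ptopologicalType).
Variables (pi : probability (borel E) R).
Variables (gamma : R.-pker (borel E) ~> (borel E)).

Definition supp : set E :=
  [set x | forall U : set E, open U -> U x -> (0 < pi U)%E].

(* pi(dx) gamma(x, dy); the one-point type [unit] turns [pi] into a kernel, as
   the product of kernels in the library expects. *)
Definition pi_gamma : {measure set (borel E * borel E) -> \bar R} :=
  mkproduct
    (kprobability
       (measurable_cst (pi : pprobability (borel E) R)
        : measurable_fun [set: unit] _))
    (kernel.kernel_snd gamma) tt.

(* [ratio_density] says that the measure pi(dy) gamma(y, dx), i.e. the image
   of [pi_gamma] under the swap, has density [t] with respect to [pi_gamma]. *)
Record is_ratio (t : E * E -> R) (S : set (E * E)) : Prop := IsRatio {
  ratio_measurable : measurable_fun [set: borel E * borel E] t ;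
  ratio_ge0 : forall z, 0 <= t z ;
  ratio_density : forall A : set (borel E * borel E), measurable A ->
    pi_gamma [set z | A (z.2, z.1)] = (\int[pi_gamma]_(z in A) (t z)%:E)%E ;
  ratio_set_measurable : measurable (S : set (borel E * borel E)) ;
  ratio_set_full : pi_gamma S = 1%E ;
  ratio_gt0 : forall x y, S (x, y) -> 0 < t (x, y) ;
  ratio_sym : forall x y, S (x, y) -> t (y, x) = (t (x, y))^-1 ;
  ratio_out : forall z, ~ S z -> t z = 0 }.

Variables (g : R -> R) (t : E * E -> R).

Definition jump_rate (x : E) : \bar R :=
  (\int[gamma x]_y (g (t (x, y)))%:E)%E.

Definition embedded_kernel (x : E) (A : set (borel E)) : \bar R :=
  if (jump_rate x == 0)%E || (jump_rate x == +oo)%E then \d_(x : borel E) A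
  else (\int[gamma x]_(y in A) (g (t (x, y)) / fine (jump_rate x))%:E)%E.

Definition weak_generator (f : E -> R) (x : E) : R :=
  \int[gamma x]_y (g (t (x, y)) * (f y - f x)).

Definition dirichlet_form (f : E -> R) : R :=
  - \int[pi]_x (f x * weak_generator f x).

Definition bounded_measurable : set (E -> R) :=
  [set f : E -> R |
    measurable_fun [set: borel E] (f : borel E -> R) /\ bounded_fun f].

(* Extended real, so that the infimum is +oo when no [f] has positive variance,
   i.e. when [pi] is trivial. *)
Definition spectral_gap : \bar R :=
  ereal_inf [set (dirichlet_form f / fine ('V_pi[f]))%:E |
             f in [set f : E -> R | bounded_measurable f /\ (0 < 'V_pi[f])%E]].

End target_and_base_kernel.

(* Exp(l) as a law on the extended half-line, with Exp(0) the Dirac mass at +oo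
   and Exp(+oo) the Dirac mass at 0. *)
Definition exp_law (R : realType) (l : \bar R) (B : set (\bar R)) : \bar R :=
  match l with
  | r%:E => if r == 0 then \d_(+oo%E : \bar R) B
            else exponential_prob r (EFin @^-1` B)
  | _ => \d_(0%E : \bar R) B
  end.

Section jump_process.
Context (R : realType) (E : ptopologicalType).
Context (d : measure_display) (Omega : measurableType d).
(* [tau k] is the holding time in state [X k], written tau_(k+1) when holding
   times are numbered from 1. *)
Variables (X : nat -> Omega -> E) (tau : nat -> Omega -> \bar R).

(* sigma(X_k : k in K) *)
Definition chain_sigma (K : set nat) : set (set Omega) :=
  <<s \bigcup_(k in K)
        preimage_set_system setT (X k : Omega -> borel E) measurable >>.

(* Under [P], [X] is a Markov chain with initial law [nu] and transition kernel
   [Gam] and, given [X], the holding times are independent with laws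
   Exp(lam (X k)). *)
Record is_jump_process (lam : E -> \bar R) (Gam : E -> set (borel E) -> \bar R)
    (nu : set (borel E) -> \bar R) (P : probability Omega R) : Prop :=
  IsJumpProcess {
  chain_measurable : forall n,
    measurable_fun [set: Omega] (X n : Omega -> borel E) ;
  holding_measurable : forall n, measurable_fun [set: Omega] (tau n) ;
  holding_ge0 : forall n w, (0 <= tau n w)%E ;
  chain_init : forall A : set (borel E), measurable A ->
    P (X 0%N @^-1` A) = nu A ;
  chain_markov : forall n (C : set Omega) (A : set (borel E)),
    chain_sigma [set k | (k <= n)%N] C -> measurable A ->
    P (C `&` X n.+1 @^-1` A) = (\int[P]_(w in C) Gam (X n w) A)%E ;
  holding_law : forall n (C : set Omega) (B : nat -> set (\bar R)),
    chain_sigma setT C -> (forall k, measurable (B k)) ->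
    P (C `&` \bigcap_(k < n) (tau k @^-1` B k)) =
    (\int[P]_(w in C) \prod_(k < n) exp_law (lam (X k w)) (B k))%E }.

Definition jump_time (n : nat) (w : Omega) : \bar R :=
  (\sum_(k < n) tau k w)%E.

(* [None] is the graveyard state. *)
Definition jump_state (s : R) (w : Omega) : option E :=
  if (s%:E < ereal_sup (range (jump_time ^~ w)))%E
  then Some (X (supremum 0%N [set n | (jump_time n w <= s%:E)%E]) w)
  else None.

Definition state_law (P : probability Omega R) (s : R) (A : set (borel E))
    : \bar R :=
  P (jump_state s @^-1` (Some @` A)).

End jump_process.

Definition chi2 (R : realType) (E : ptopologicalType)
    (mu pi : probability (borel E) R) : \bar R :=
  (\int[pi]_x (Radon_Nikodym (charge_of_finite_measure mu) pi x - 1) ^+ 2)%E.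

Definition tv_dist (R : realType) (E : ptopologicalType)
    (mu nu : set (borel E) -> \bar R) : \bar R :=
  ereal_sup [set `|mu A - nu A|%E | A in [set A | measurable A]].

(* Main.v *)
Require Import Defs.
From mathcomp Require Import ring lra.
From HB Require Import structures.
From mathcomp Require Import all_boot all_order all_algebra.
From mathcomp Require Import finmap.
From mathcomp Require Import all_classical all_reals all_analysis measurable_realfun.

Import Order.TTheory GRing.Theory Num.Theory.
Import numFieldNormedType.Exports.

Set Implicit Arguments.
Unset Strict Implicit.
Unset Printing Implicit Defensive.

Local Open Scope classical_set_scope.
Local Open Scope ring_scope.

(** Write [b(x, y) = g(t(x, y))].  The identity [g(s) = s g(1/s)] makes the
    measure [b(x, y) pi(dx) gamma(x, dy)] symmetric under the exchange of [x]
    and [y] ([balanced_symmetric]): the jump process is reversible, and for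
    every nonnegative [f] the integral over [pi] of [x |-> \int b(x, y) f(y)
    gamma(x, dy)] is that of [lambda f].  Since [g] is monotone with [g(1) = 1],
    that identity also gives [g(s) <= 1 + s], so [lambda] is [pi]-integrable,
    and [lambda > 0] almost everywhere because [b > 0] on a set of full measure.
    Degenerate states are thus [pi]-null; redefining the rates there yields a
    density [q] and a rate [l] with values in [(0, oo)]
    ([regular_density], [regular_rate]) to which the analysis applies pointwise.

    Let [P_s(x)] be the probability of being in [A] at time [s] from [x], built
    as the sum over [n] of the probability of being there after exactly [n]
    jumps ([transition]).  Conditioning on the first jump gives a renewal
    equation, and differentiating it in [s], for each fixed [x], the backward
    equation [d/ds P_s = L P_s] ([is_derive_transition_prob]).  As
    [`|L P_s| <= l] with [l] integrable, one may differentiate under the integral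
    against [pi]: the mean of [P_s] is constant, equal to [pi(A)]
    ([mean_transition]), and the derivative of [\int P_s^2] is
    [2 \int P_s L P_s], at most [-2 gap Var(P_s)] by the definition of the
    spectral gap ([spectral_gap_poincare]).  Hence
    [Var(P_s) <= exp(-2 gap s) Var(P_0)] ([variance_decay]), where
    [Var(P_0) = pi(A)(1 - pi(A)) <= 1/4].  This pointwise route replaces any
    discussion of the domain of an unbounded generator on [L^2(pi)].

    If [mu] has density [h] with respect to [pi], then
    [\int P_s dmu - pi(A) = \int (P_s - pi(A)) (h - 1) dpi], and the
    Cauchy-Schwarz inequality bounds it by the square root of
    [Var(P_s) chi2(mu | pi)] ([mean_difference_le]), which is the asserted bound.

    What remains is that [\int P_s dmu] is the law at time [s] of the given
    process ([state_law_transition]).  As [mu << pi], no [X_n] ever visits the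
    degenerate states, almost surely; the event of being in [A] after exactly [n]
    jumps is then integrated out one holding time and one jump at a time.  The
    two conditional laws, of [tau_n] given [X_n] and the first [n] holding times
    and of [X_(n+1)] given [X_n] and the first [n + 1] of them, are obtained on
    rectangles from the defining properties of the process and extended by a
    monotone class argument ([integral_conditional]). *)

(** * Integration against densities and kernels *)

Section generic_measure.
Local Open Scope ereal_scope.

Import HBNNSimple.

(** The standard machine: by approximation with simple functions, a property of
    nonnegative functions that holds for indicators and is stable under sums,
    scaling and monotone limits holds for all of them. *)
Lemma ge0_measurable_ind d (T : measurableType d) (R : realType)
    (Phi : (T -> \bar R) -> Prop) :
  (forall A, measurable A -> Phi (fun x => (\1_A x)%:E)) ->
  (forall f g : T -> \bar R, measurable_fun setT f -> measurable_fun setT g ->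
     (forall x, 0 <= f x) -> (forall x, 0 <= g x) ->
     Phi f -> Phi g -> Phi (fun x => f x + g x)) ->
  (forall (r : R) (f : T -> \bar R), (0 <= r)%R -> measurable_fun setT f ->
     (forall x, 0 <= f x) -> Phi f -> Phi (fun x => r%:E * f x)) ->
  (forall f_ : nat -> T -> \bar R, (forall n, measurable_fun setT (f_ n)) ->
     (forall n x, 0 <= f_ n x) -> (forall x, nondecreasing_seq (f_ ^~ x)) ->
     (forall n, Phi (f_ n)) -> Phi (fun x => limn (f_ ^~ x))) ->
  forall f : T -> \bar R, measurable_fun setT f -> (forall x, 0 <= f x) -> Phi f.
Proof.
move=> Pindic Padd Pscale Plim f mf f0.
pose f_ := nnsfun_approx measurableT mf.
have -> : f = fun x => limn (fun n => (f_ n x)%:E).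
  apply/funext => x; apply/esym/cvg_lim => //.
  exact: (@cvg_nnsfun_approx _ _ _ _ measurableT _ mf (fun x _ => f0 x) x).
apply: Plim => [n|n x|x m n mn|n].
- exact/measurable_EFinP.
- by rewrite lee_fin.
- by rewrite lee_fin; exact/lefP/nd_nnsfun_approx.
have mfr r : measurable (f_ n @^-1` [set r]) by [].
rewrite (_ : (fun x => (f_ n x)%:E) = (fun x => \sum_(r <- enum_fset (fset_set (range (f_ n))))
  (r%:E * (\1_(f_ n @^-1` [set r]) x)%:E))); last first.
  by apply/funext => x; rewrite fimfunE fsbig_finite//= -sumEFin.
have : forall r, r \in enum_fset (fset_set (range (f_ n))) -> (0 <= r)%R.
  by move=> r; rewrite in_fset_set// inE => -[x _ <-].
elim: (enum_fset _) => [_|r s IH s0].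
  rewrite (_ : (fun x => _) = (fun x : T => (\1_set0 x)%:E)); first exact: Pindic.
  by apply/funext => x; rewrite big_nil indic0.
have r0 : (0 <= r)%R by exact: (s0 _ (mem_head _ _)).
have {}IH := IH (fun a sa => s0 a (@mem_behead _ (r :: s) _ sa)).
under eq_fun do rewrite big_cons.
have mi a : measurable_fun setT (fun x => (\1_(f_ n @^-1` [set a]) x)%:E : \bar R).
  by apply/measurable_EFinP; exact: measurable_indic.
apply: (Padd (fun x => r%:E * (\1_(f_ n @^-1` [set r]) x)%:E)
  (fun x => \sum_(j <- s) j%:E * (\1_(f_ n @^-1` [set j]) x)%:E)) => //.
- exact: measurable_funeM.
- apply: emeasurable_sum => a; exact: measurable_funeM.
- by move=> x; rewrite mule_ge0// lee_fin.
- move=> x; rewrite big_seq sume_ge0// => a sa; rewrite mule_ge0// lee_fin//.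
  exact: (s0 _ (@mem_behead _ (r :: s) _ sa)).
- apply: Pscale => //; exact: Pindic.
Qed.

(** The map [phi] lets the density live on the source of an image measure; with
    [phi := id] this is the usual change of measure. *)
Lemma integral_density d d' (T : measurableType d) (T' : measurableType d')
    (R : realType) (mu : {measure set T -> \bar R})
    (nu : {measure set T' -> \bar R}) (phi : T -> T') (h : T -> \bar R) :
  measurable_fun setT phi -> measurable_fun setT h -> (forall x, 0 <= h x) ->
  (forall x, h x \is a fin_num) ->
  (forall A, measurable A -> nu A = \int[mu]_(x in phi @^-1` A) h x) ->
  forall f : T' -> \bar R, measurable_fun setT f -> (forall x, 0 <= f x) ->
    \int[nu]_y f y = \int[mu]_x (f (phi x) * h x).
Proof.
move=> mphi mh h0 hfin nuE f mf f0.
apply: (ge0_measurable_ind (Phi := fun f => \int[nu]_y f y =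
  \int[mu]_x (f (phi x) * h x))) f mf f0.
- move=> A mA; rewrite integral_indic// setIT nuE// integral_mkcond.
  apply: eq_integral => x _; rewrite patchE indicE.
  rewrite -(_ : (phi x \in A) = (x \in phi @^-1` A)); last by [].
  by case: ifPn => _; rewrite ?mul1e ?mul0e.
- move=> f g mf mg f0 g0 Hf Hg; rewrite ge0_integralD// Hf Hg -ge0_integralD//.
  + by apply: eq_integral => x _; rewrite ge0_muleDl.
  + by move=> x _; rewrite mule_ge0.
  + by apply: emeasurable_funM => //; exact: measurableT_comp.
  + by move=> x _; rewrite mule_ge0.
  + by apply: emeasurable_funM => //; exact: measurableT_comp.
- move=> r f r0 mf f0 Hf; rewrite ge0_integralZl// Hf -ge0_integralZl//.
  + by apply: eq_integral => x _; rewrite muleA.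
  + by apply: emeasurable_funM => //; exact: measurableT_comp.
  + by move=> x _; rewrite mule_ge0.
- move=> f_ mf_ f_0 nd Hf.
  rewrite monotone_convergence//.
  under eq_fun do rewrite Hf.
  rewrite -monotone_convergence//.
  + apply: eq_integral => x _; rewrite -limeMr//.
    by apply: ereal_nondecreasing_is_cvgn; exact: nd.
  + by move=> n; apply: emeasurable_funM => //; exact: measurableT_comp.
  + by move=> n x _; rewrite mule_ge0.
  + by move=> x _ m n mn; rewrite lee_wpmul2r//; exact: nd.
Qed.

(** The dual situation, the density now living on the target: this is how a
    Radon-Nikodym derivative between a measure and its image under an exchange of
    coordinates is used. *)
Lemma integral_comp_density d d' (T : measurableType d) (T' : measurableType d')
    (R : realType) (mu : {measure set T -> \bar R})
    (nu : {measure set T' -> \bar R}) (phi : T -> T') (h : T' -> \bar R) :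
  measurable_fun setT phi -> measurable_fun setT h -> (forall y, 0 <= h y) ->
  (forall y, h y \is a fin_num) ->
  (forall A, measurable A -> mu (phi @^-1` A) = \int[nu]_(y in A) h y) ->
  forall f : T' -> \bar R, measurable_fun setT f -> (forall y, 0 <= f y) ->
    \int[mu]_x f (phi x) = \int[nu]_y (f y * h y).
Proof.
move=> mphi mh h0 hfin muE f mf f0.
transitivity (\int[pushforward mu phi]_y f y).
  by rewrite (ge0_integral_pushforward mphi mu measurableT mf).
exact: (integral_density (nu := pushforward mu phi) (phi := id)).
Qed.
Lemma ge0_integral_reflect (R : realType) (f : R -> \bar R) (t : R) :
  measurable_fun setT f -> (forall r, 0 <= f r) ->
  \int[lebesgue_measure]_r f (t - r)%R = \int[lebesgue_measure]_r f r.
Proof.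
move=> mf f0.
pose phi : measurableTypeR R -> measurableTypeR R := fun r => (t - r)%R.
have mphi : measurable_fun setT phi by exact: measurable_funB.
rewrite -[LHS](_ : \int[pushforward lebesgue_measure phi]_r f r = _); last first.
  rewrite (@ge0_integral_pushforward _ _ _ _ _ phi mphi lebesgue_measure)//.
apply: eq_measure_integral => A mA _; apply/esym.
apply: (@lebesgue_measure_unique _ (pushforward lebesgue_measure phi)) => //.
move=> _ [[a b]] _ <-.
transitivity (lebesgue_measure (phi @^-1` [set` `]a, b]])); last by [].
have -> : phi @^-1` [set` `]a, b]] = `[(t - b)%R, (t - a)%R[%classic.
  by apply/seteqP; split => x; rewrite /phi/= !in_itv/= => /andP[? ?];
    apply/andP; split; lra.
rewrite !lebesgue_measure_itv/= !lte_fin ltrD2l ltrN2 -!EFinB.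
by case: ifPn => // _; congr (_%:E); ring.
Qed.

Section semidirect.
Context d1 d2 (T1 : measurableType d1) (T2 : measurableType d2) (R : realType).
Variables (mu : probability T1 R) (k : R.-spker T1 ~> T2).

Lemma measurable_integral_spker (f : T1 * T2 -> \bar R) :
  measurable_fun setT f -> (forall z, 0 <= f z) ->
  measurable_fun setT (fun x => \int[k x]_y f (x, y)).
Proof. by move=> mf f0; exact: measurable_fun_integral_finite_kernel. Qed.

Lemma ge0_integral_disintegrate (nu : {measure set (T1 * T2) -> \bar R}) :
  (forall A, measurable A -> nu A = \int[mu]_x \int[k x]_y (\1_A (x, y))%:E) ->
  forall f : T1 * T2 -> \bar R,
  measurable_fun setT f -> (forall z, 0 <= f z) ->
  \int[nu]_z f z = \int[mu]_x \int[k x]_y f (x, y).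
Proof.
move=> nuE.
have mp (f' : T1 * T2 -> \bar R) x : measurable_fun setT f' ->
    measurable_fun setT (fun y => f' (x, y)).
  by move=> mf'; exact: measurableT_comp.
have mi A : measurable A -> measurable_fun setT (fun z : T1 * T2 => (\1_A z)%:E : \bar R).
  by move=> mA; apply/measurable_EFinP; exact: measurable_indic.
apply: ge0_measurable_ind.
- by move=> A mA; rewrite integral_indic// setIT nuE.
- move=> f g mf mg f0 g0 Hf Hg; rewrite (@ge0_integralD _ _ _ nu) ?Hf ?Hg//.
  rewrite -(@ge0_integralD _ _ _ mu)//.
  + by apply: eq_integral => x _; rewrite (@ge0_integralD _ _ _ (k x))//; exact: mp.
  + by move=> x _; exact: integral_ge0.
  + exact: measurable_integral_spker.
  + by move=> x _; exact: integral_ge0.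
  + exact: measurable_integral_spker.
- move=> r f r0 mf f0 Hf; rewrite (@ge0_integralZl _ _ _ nu) ?Hf//.
  rewrite -(@ge0_integralZl _ _ _ mu)//.
  + by apply: eq_integral => x _; rewrite (@ge0_integralZl _ _ _ (k x))//; exact: mp.
  + exact: measurable_integral_spker.
  + by move=> x _; exact: integral_ge0.
- move=> f_ mf_ f_0 nd Hf.
  rewrite monotone_convergence//.
  under eq_fun do rewrite Hf.
  rewrite -monotone_convergence//.
  + apply: eq_integral => x _; rewrite monotone_convergence//.
    * by move=> n; exact: mp.
  + by move=> n; exact: measurable_integral_spker.
  + by move=> n x _; exact: integral_ge0.
  + move=> x _ m n mn; apply: ge0_le_integral => //; [exact: mp|exact: mp|].
    by move=> y _; exact: nd.
Qed.

(** The measure [mu(dx) k(x, dy)]: [mu] is seen as a kernel from a one-point space, so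
    that it can be composed with [k]. *)
Definition semidirect : {measure set (T1 * T2) -> \bar R} :=
  mkproduct
    (kprobability (measurable_cst (mu : pprobability T1 R)
        : measurable_fun [set: unit] _))
    (kernel.kernel_snd k) tt.

Lemma semidirect_indic A : measurable A ->
  semidirect A = \int[mu]_x \int[k x]_y (\1_A (x, y))%:E.
Proof. by []. Qed.

Lemma integral_semidirect (f : T1 * T2 -> \bar R) :
  measurable_fun setT f -> (forall z, 0 <= f z) ->
  \int[semidirect]_z f z = \int[mu]_x \int[k x]_y f (x, y).
Proof. exact: ge0_integral_disintegrate semidirect_indic f. Qed.

End semidirect.

Section mdensity.
Context d (T : measurableType d) (R : realType).
Variables (mu : {measure set T -> \bar R}) (h : T -> \bar R).

(** The two proofs are arguments so that the measure structure declared below can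
    be found from the term alone. *)
Definition mdensity (mh : measurable_fun setT h) (h0 : forall x, 0 <= h x)
  (A : set T) : \bar R := \int[mu]_(x in A) h x.

Variables (mh : measurable_fun setT h) (h0 : forall x, 0 <= h x).

Let mdensity0 : mdensity mh h0 set0 = 0.
Proof. exact: integral_set0. Qed.

Let mdensity_ge0 A : 0 <= mdensity mh h0 A.
Proof. exact: integral_ge0. Qed.

Let mdensity_sigma_additive : semi_sigma_additive (mdensity mh h0).
Proof.
move=> /= F mF tF mUF; rewrite /mdensity; apply: cvg_toP.
  apply: ereal_nondecreasing_is_cvgn => m n mn.
  by apply: lee_sum_nneg_natr => // k _ _; exact: integral_ge0.
by rewrite ge0_integral_bigcup//=; exact: measurable_funTS.
Qed.

HB.instance Definition _ := isMeasure.Build _ _ _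
  (mdensity mh h0) mdensity0 mdensity_ge0 mdensity_sigma_additive.

End mdensity.

End generic_measure.

(** * Conditional laws from rectangles *)

Section conditional_law.
Local Open Scope ereal_scope.

(** If [k (Z w)] is the conditional law of [W] on each event of a pi-system [G]
    that determines [Z], it is the conditional law of [W] given [Z] on all
    functions of the pair.  Two uniqueness theorems are chained: one on [G],
    where [H |-> P (H `&` W @^-1` B)] and [H |-> \int[P]_(w in H) k (Z w) B] agree,
    and one on rectangles [A `*` B], which reduces to the first with
    [H = Z @^-1` A]. *)
Lemma integral_conditional d d1 d2 (Omega : measurableType d)
    (T1 : measurableType d1) (T2 : measurableType d2) (R : realType)
    (P : probability Omega R) (Z : Omega -> T1) (W : Omega -> T2)
    (k : R.-spker T1 ~> T2) (G : set (set Omega)) :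
  G `<=` measurable -> setI_closed G -> G setT ->
  (forall A, measurable A -> <<s G >> (Z @^-1` A)) ->
  measurable_fun setT W ->
  (forall H B, G H -> measurable B ->
     P (H `&` W @^-1` B) = \int[P]_(w in H) k (Z w) B) ->
  forall F : T1 * T2 -> \bar R, measurable_fun setT F -> (forall z, 0 <= F z) ->
  \int[P]_w F (Z w, W w) = \int[P]_w \int[k (Z w)]_y F (Z w, y).
Proof.
move=> Gm GI GT GZ mW PG F mF F0.
have sGm := smallest_sub (@sigma_algebra_measurable _ Omega) Gm.
have mZ : measurable_fun setT Z.
  by move=> _ A mA; rewrite setTI; apply: sGm; exact: GZ.
pose Zm := isMeasurableFun.Build _ _ _ _ _ mZ.
pose Z' : {RV P >-> T1} := HB.pack_for {RV P >-> T1} Z Zm.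
have mZW : measurable_fun setT (fun w => (Z w, W w)) by exact: measurable_fun_pair.
transitivity (\int[pushforward P (fun w => (Z w, W w))]_z F z).
  by rewrite ge0_integral_pushforward.
transitivity (\int[semidirect (distribution P Z') k]_z F z); last first.
  rewrite integral_semidirect//.
  rewrite ge0_integral_pushforward//.
    exact: measurable_integral_spker.
  by move=> x _; exact: integral_ge0.
apply: eq_measure_integral => C mC _.
pose GG := [set A `*` B | A in @measurable _ T1 & B in @measurable _ T2].
apply: (@measure_unique _ _ _ GG (fun=> setT)) => //.
- by rewrite measurable_prod_measurableType.
- move=> _ _ [A mA [B mB <-]] [A' mA' [B' mB' <-]].
  by rewrite -setXI; exists (A `&` A'); [exact: measurableI|];
    exists (B `&` B') => //; exact: measurableI.
- by move=> _; exists setT => //; exists setT => //; rewrite setXTT.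
- by rewrite bigcup_const.
- move=> _ [A mA [B mB <-]].
  rewrite semidirect_indic; last exact: measurableX.
  rewrite ge0_integral_pushforward//; last 2 first.
    apply: (measurable_integral_spker k (f := fun z => (\1_(A `*` B) z)%:E)).
      by apply/measurable_EFinP; apply: measurable_indic; exact: measurableX.
    by move=> z; rewrite lee_fin.
    by move=> x _; apply: integral_ge0 => y _; rewrite lee_fin.
  transitivity (\int[P]_(w in Z @^-1` A) k (Z w) B); last first.
    apply/esym; rewrite [RHS]integral_mkcond preimage_setT; apply: eq_integral => w _.
    rewrite patchE /=; case: ifPn => ZA.
      transitivity (\int[k (Z w)]_y (\1_B y)%:E).
        2: by rewrite integral_indic// setIT.
      apply: eq_integral => y _; rewrite !indicE; congr (_%:R%:E); congr nat_of_bool.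
      move: ZA; rewrite inE /= => ZA.
      by apply/idP/idP; rewrite !inE/= => // -[].
    rewrite integral0_eq// => y _; rewrite indicE memNset//= => -[ZA' _].
    by move: ZA; rewrite notin_setE.
  transitivity (P (Z @^-1` A `&` W @^-1` B)); first by [].
  have {mA} := GZ _ mA; move: (Z @^-1` A) => H sGH.
  have mk : measurable_fun setT (fun w => k (Z w) B).
    exact: (measurableT_comp (measurable_kernel k B mB) mZ).
  have k0 w : 0 <= k (Z w) B by [].
  rewrite -(setTI (W @^-1` B)).
  apply: (@g_sigma_algebra_measure_unique _ _ _ G Gm (fun=> setT) _ _
    (mrestr P (mW measurableT _ mB)) (mdensity P mk k0)) => //.
  - by rewrite bigcup_const.
  - move=> H' GH'; transitivity (P (H' `&` W @^-1` B)); last exact: PG.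
    by rewrite -[in RHS](setTI (W @^-1` B)).
  - move=> _; apply: le_lt_trans (probability_le1 P _) _; last exact: ltry.
    by apply: measurableI => //; exact: mW.
- move=> _; apply: le_lt_trans (probability_le1 P _) _; last exact: ltry.
  by rewrite -[X in measurable X]setTI; exact: mZW.
Qed.
End conditional_law.

(** * One jump of the process *)

Section jump_semigroup.
Context d (T : measurableType d) (R : realType).
Variables (gam : R.-pker T ~> T) (q : T * T -> R) (l : T -> R).
Hypothesis mq : measurable_fun setT q.
Hypothesis q_ge0 : forall z, 0 <= q z.
Hypothesis ml : measurable_fun setT l.
Hypothesis l_gt0 : forall x, 0 < l x.
Hypothesis lE : forall x, (\int[gam x]_y (q (x, y))%:E = (l x)%:E)%E.
Local Open Scope ereal_scope.

Implicit Types (F G : R * T -> \bar R) (z : R * T) (x y : T).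

(** Functions are of a pair (time left, state); the time is a parameter here. *)
Definition rate_op (F : R * T -> \bar R) (z : R * T) : \bar R :=
  \int[gam z.2]_y ((q (z.2, y))%:E * F (z.1, y)).

Lemma measurable_rate_op F : measurable_fun setT F -> (forall z, 0 <= F z) ->
  measurable_fun setT (rate_op F).
Proof.
move=> mF F0.
pose k (w : (R * T) * T) := (q (w.1.2, w.2))%:E * F (w.1.1, w.2).
apply: (measurable_fun_integral_finite_kernel k (kernel.kernel_snd gam)).
  by move=> w; rewrite /k mule_ge0// lee_fin.
apply: emeasurable_funM.
  apply/measurable_EFinP; apply: (measurableT_comp mq).
  apply: measurable_fun_pair => //.
  exact: measurableT_comp.
apply: (measurableT_comp mF).
apply: measurable_fun_pair => //.
exact: measurableT_comp.
Qed.

Lemma rate_op_ge0 F z : (forall z, 0 <= F z) -> 0 <= rate_op F z.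
Proof. by move=> F0; apply: integral_ge0 => y _; rewrite mule_ge0// lee_fin. Qed.

Let mqs x : measurable_fun setT (fun y => (q (x, y))%:E).
Proof. by apply/measurable_EFinP; exact: measurableT_comp. Qed.

Let mqF F s x : measurable_fun setT F ->
  measurable_fun setT (fun y => (q (x, y))%:E * F (s, y)).
Proof. by move=> mF; apply: emeasurable_funM => //; exact: measurableT_comp. Qed.

(** The operator [F |-> E_x[F(s - tau, X_1)]], where [tau] is exponential of rate
    [l x] and [X_1] has law [q(x, y) gam(x, dy) / l x]: the factor [l x] of the
    exponential density cancels the normalization of the jump.  It is a total
    function of [s], and the time left may become negative. *)
Definition jump_step (F : R * T -> \bar R) (z : R * T) : \bar R :=
  \int[lebesgue_measure]_(r in `[0%R, +oo[)
    ((expR (- l z.2 * r))%:E * rate_op F ((z.1 - r)%R, z.2)).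

Lemma measurable_jump_integrand F : measurable_fun setT F -> (forall z, 0 <= F z) ->
  measurable_fun setT (fun w : (R * T) * R =>
    (expR (- l w.1.2 * w.2))%:E * rate_op F ((w.1.1 - w.2)%R, w.1.2)).
Proof.
move=> mF F0; apply: emeasurable_funM.
  apply/measurable_EFinP; apply: measurableT_comp => //.
  apply: measurable_funM => //; apply: measurableT_comp => //.
  apply: (measurableT_comp ml); exact: measurableT_comp.
apply: (measurableT_comp (measurable_rate_op mF F0)).
apply: measurable_fun_pair.
  by apply: measurable_funB => //; exact: measurableT_comp.
exact: measurableT_comp.
Qed.

Let mstep F z : measurable_fun setT F -> (forall z, 0 <= F z) ->
  measurable_fun setT (fun r : R =>
    (expR (- l z.2 * r))%:E * rate_op F ((z.1 - r)%R, z.2)).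
Proof.
move=> mF F0; have m := measurable_jump_integrand mF F0.
exact: (measurableT_comp m (pair1_measurable z)).
Qed.

Let step0 F z r : (forall z, 0 <= F z) ->
  0 <= (expR (- l z.2 * r))%:E * rate_op F ((z.1 - r)%R, z.2).
Proof. by move=> F0; rewrite mule_ge0 ?lee_fin ?expR_ge0// rate_op_ge0. Qed.

Lemma jump_step_ge0 F z : (forall z, 0 <= F z) -> 0 <= jump_step F z.
Proof. by move=> F0; apply: integral_ge0 => r _; exact: step0. Qed.

Lemma measurable_jump_step F : measurable_fun setT F -> (forall z, 0 <= F z) ->
  measurable_fun setT (jump_step F).
Proof.
move=> mF F0.
pose k (w : (R * T) * R) := (\1_(`[0%R, +oo[%classic : set R) w.2)%:E *
  ((expR (- l w.1.2 * w.2))%:E * rate_op F ((w.1.1 - w.2)%R, w.1.2)).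
rewrite (_ : jump_step F = fubini_F lebesgue_measure k); last first.
  apply/funext => z; rewrite /jump_step /fubini_F [LHS]integral_mkcond.
  apply: eq_integral => r _; rewrite /k/= patchE indicE.
  by case: ifPn => _; rewrite ?mul1e ?mul0e.
apply: measurable_fun_fubini_tonelli_F; last first.
  by move=> w; rewrite /k mule_ge0 ?lee_fin//; exact: step0.
apply: emeasurable_funM; last exact: measurable_jump_integrand.
by apply/measurable_EFinP; apply: measurableT_comp.
Qed.

Lemma rate_opD F G z : measurable_fun setT F -> measurable_fun setT G ->
  (forall z, 0 <= F z) -> (forall z, 0 <= G z) ->
  rate_op (fun z => F z + G z) z = rate_op F z + rate_op G z.
Proof.
move=> mF mG F0 G0; rewrite /rate_op -(@ge0_integralD _ _ _ (gam z.2))//.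
- by apply: eq_integral => y _; rewrite ge0_muleDr.
- by move=> y _; rewrite mule_ge0// lee_fin.
- exact: mqF.
- by move=> y _; rewrite mule_ge0// lee_fin.
- exact: mqF.
Qed.

Lemma jump_stepD F G z : measurable_fun setT F -> measurable_fun setT G ->
  (forall z, 0 <= F z) -> (forall z, 0 <= G z) ->
  jump_step (fun z => F z + G z) z = jump_step F z + jump_step G z.
Proof.
move=> mF mG F0 G0; rewrite /jump_step -(@ge0_integralD _ _ _ lebesgue_measure)//.
- by apply: eq_integral => y _; rewrite rate_opD// ge0_muleDr ?rate_op_ge0.
- by move=> r _; exact: step0.
- by apply: measurable_funTS; exact: mstep.
- by move=> r _; exact: step0.
- by apply: measurable_funTS; exact: mstep.
Qed.

Lemma rate_op_nneseries (F : nat -> R * T -> \bar R) z :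
  (forall n, measurable_fun setT (F n)) -> (forall n z, 0 <= F n z) ->
  rate_op (fun z => \sum_(0 <= n <oo) F n z) z = \sum_(0 <= n <oo) rate_op (F n) z.
Proof.
move=> mF F0; rewrite /rate_op -integral_nneseries//.
- by apply: eq_integral => y _; rewrite nneseriesZl.
- by move=> n; exact: mqF.
- by move=> n y _; rewrite mule_ge0// lee_fin.
Qed.

Lemma jump_step_nneseries (F : nat -> R * T -> \bar R) z :
  (forall n, measurable_fun setT (F n)) -> (forall n z, 0 <= F n z) ->
  jump_step (fun z => \sum_(0 <= n <oo) F n z) z =
  \sum_(0 <= n <oo) jump_step (F n) z.
Proof.
move=> mF F0; rewrite /jump_step -integral_nneseries//.
- apply: eq_integral => y _; rewrite rate_op_nneseries// nneseriesZl//.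
  by move=> n _; rewrite rate_op_ge0.
- by move=> n; apply: measurable_funTS; exact: mstep.
- by move=> n y _; exact: step0.
Qed.

Lemma le_rate_op F G z : measurable_fun setT F -> measurable_fun setT G ->
  (forall z, 0 <= F z) -> (forall z, F z <= G z) -> rate_op F z <= rate_op G z.
Proof.
move=> mF mG F0 FG; apply: ge0_le_integral => //.
- by move=> y _; rewrite mule_ge0// lee_fin.
- exact: mqF.
- exact: mqF.
- by move=> y _; rewrite lee_wpmul2l// lee_fin.
Qed.

Lemma le_jump_step F G z : measurable_fun setT F -> measurable_fun setT G ->
  (forall z, 0 <= F z) -> (forall z, F z <= G z) ->
  jump_step F z <= jump_step G z.
Proof.
move=> mF mG F0 FG; have G0 z' : 0 <= G z' by exact: le_trans (FG z').
apply: ge0_le_integral => //.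
- by move=> r _; exact: step0.
- by apply: measurable_funTS; exact: mstep.
- by apply: measurable_funTS; exact: mstep.
- by move=> r _; rewrite lee_wpmul2l ?lee_fin ?expR_ge0// le_rate_op.
Qed.

Definition nonneg_time (z : R * T) : \bar R := (\1_(`[0%R, +oo[%classic : set R) z.1)%:E.

Lemma measurable_nonneg_time : measurable_fun setT nonneg_time.
Proof. by apply/measurable_EFinP; apply: measurableT_comp. Qed.

Lemma nonneg_time_ge0 z : 0 <= nonneg_time z. Proof. by rewrite lee_fin. Qed.

Lemma rate_op_nonneg_time z : rate_op nonneg_time z = (l z.2)%:E * nonneg_time z.
Proof.
rewrite /rate_op /nonneg_time/=.
under eq_integral do rewrite muleC.
rewrite ge0_integralZl ?lee_fin//; first by rewrite [X in _ * X]lE muleC.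
by move=> y _; rewrite lee_fin.
Qed.

(** The probability that the first jump occurs before the time is up. *)
Lemma jump_step_nonneg_time z : jump_step nonneg_time z = (1 - (expR (- l z.2 * z.1))%:E) * nonneg_time z.
Proof.
rewrite /jump_step.
under eq_integral do rewrite rate_op_nonneg_time.
have [z0|z0] := ltP z.1 0%R.
  rewrite {2}/nonneg_time indicE memNset ?mule0/=; last first.
    by rewrite in_itv/= andbT leNgt z0.
  rewrite integral0_eq// => r; rewrite /= in_itv/= andbT => r0.
  by rewrite /nonneg_time indicE memNset ?mule0//= in_itv/= andbT; apply/negP; rewrite -ltNge; lra.
rewrite {2}/nonneg_time indicE mem_set ?mule1/=; last by rewrite in_itv/= andbT.
transitivity (\int[lebesgue_measure]_(r in `[0%R, z.1]) (exponential_pdf (l z.2) r)%:E).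
  rewrite [LHS]integral_mkcond [RHS]integral_mkcond; apply: eq_integral => r _.
  rewrite !patchE !mem_setE /nonneg_time indicE/= !mem_setE !in_itv/= subr_ge0.
  have [r0|r0]//= := leP 0%R r.
  case: ifPn => [rz|rz]; rewrite ?mule0// mule1 -EFinM mulrC.
  by rewrite exponential_pdfE.
move: z0; rewrite le_eqVlt => /predU1P[<-|z0].
  by rewrite set_itv1 integral_set1 mulr0 expR0 subee.
exact: exponential_prob_itv0c.
Qed.

End jump_semigroup.

(** * The transition function *)

Section transition_function.
Context d (T : measurableType d) (R : realType).
Variables (gam : R.-pker T ~> T) (q : T * T -> R) (l : T -> R).
Hypothesis mq : measurable_fun setT q.
Hypothesis q_ge0 : forall z, 0 <= q z.
Hypothesis ml : measurable_fun setT l.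
Hypothesis l_gt0 : forall x, 0 < l x.
Hypothesis lE : forall x, (\int[gam x]_y (q (x, y))%:E = (l x)%:E)%E.
Variables (A : set T) (mA : measurable A).
Local Open Scope ereal_scope.
Implicit Types (F G : R * T -> \bar R) (z : R * T) (x y : T).

Local Notation step := (jump_step gam q l).

(** The probability of sitting in [A] without having jumped; it vanishes at
    negative times, so that iterating [step] only counts jumps that occur before
    the time is up. *)
Definition no_jump z : \bar R :=
  nonneg_time z * (\1_A z.2 * expR (- l z.2 * z.1))%:E.

Lemma measurable_no_jump : measurable_fun setT no_jump.
Proof.
apply: emeasurable_funM; first exact: measurable_nonneg_time.
apply/measurable_EFinP; apply: measurable_funM.
  by apply: measurableT_comp => //; exact: measurable_indic.
apply: measurableT_comp => //; apply: measurable_funM => //.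
by apply: measurableT_comp => //; exact: measurableT_comp.
Qed.

Lemma no_jump_ge0 z : 0 <= no_jump z.
Proof. by rewrite mule_ge0// lee_fin// mulr_ge0// expR_ge0. Qed.

Definition after_jumps n : R * T -> \bar R := iter n step no_jump.

Lemma after_jumps_ge0 n z : 0 <= after_jumps n z.
Proof.
elim: n z => [|n IH] z; [exact: no_jump_ge0|exact: jump_step_ge0].
Qed.

Lemma measurable_after_jumps n : measurable_fun setT (after_jumps n).
Proof.
elim: n => [|n IH]; [exact: measurable_no_jump|].
by apply: measurable_jump_step => //; exact: after_jumps_ge0.
Qed.

Let partial_sum n z := \sum_(0 <= i < n) after_jumps i z.

Let partial_sum_ge0 n z : 0 <= partial_sum n z.
Proof. by apply: sume_ge0 => i _; exact: after_jumps_ge0. Qed.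

Let measurable_partial_sum n : measurable_fun setT (partial_sum n).
Proof. by apply: emeasurable_sum => i; exact: measurable_after_jumps. Qed.

Let partial_sum_recr n : partial_sum n.+1 = fun z => partial_sum n z + after_jumps n z.
Proof. by apply/funext => z; rewrite /partial_sum big_nat_recr. Qed.

Lemma after_jumpsS n : after_jumps n.+1 = step (after_jumps n).
Proof. by []. Qed.

(** Peeling off the first jump rather than the last one. *)
Let partial_sumS n z : partial_sum n.+1 z = no_jump z + step (partial_sum n) z.
Proof.
elim: n z => [|n IH] z.
  rewrite /partial_sum big_nat1 [X in _ + X]integral0_eq ?adde0// => r _.
  by rewrite [X in _ * X]integral0_eq ?mule0// => y _; rewrite big_nil mule0.
rewrite [in LHS]partial_sum_recr IH [in RHS]partial_sum_recr after_jumpsS.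
rewrite (jump_stepD gam mq q_ge0 ml z (measurable_partial_sum n)
  (measurable_after_jumps n) (partial_sum_ge0 n) (after_jumps_ge0 n)).
exact/esym/addeA.
Qed.

(** By induction on the number of jumps: no jump has probability at most
   [exp (- l s)], and at least one has probability [1 - exp (- l s)]. *)
Let partial_sum_le n z : partial_sum n z <= nonneg_time z.
Proof.
elim: n z => [|n IH] z; first by rewrite /partial_sum big_nil nonneg_time_ge0.
rewrite partial_sumS.
apply: (@le_trans _ _ (no_jump z + step (@nonneg_time _ T R) z)).
  apply: leeD2l; apply: le_jump_step => //; exact: measurable_nonneg_time.
rewrite jump_step_nonneg_time// /no_jump /jump_step muleC; move: (nonneg_time_ge0 z).
rewrite /nonneg_time indicE; case: (_ \in _) => _; last by rewrite !mule0 adde0.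
rewrite !mule1 -EFinB -EFinD lee_fin indicE.
case: (_ \in _); rewrite ?mul1r ?mul0r; first by rewrite /=; lra.
by have := expR_ge0 (- l z.2 * z.1); rewrite /=; lra.
Qed.

Definition transition z : \bar R := \sum_(0 <= n <oo) after_jumps n z.

Lemma measurable_transition : measurable_fun setT transition.
Proof.
apply: ge0_emeasurable_sum => [n x _ _|n _]; first exact: after_jumps_ge0.
exact: measurable_after_jumps.
Qed.

Lemma transition_ge0 z : 0 <= transition z.
Proof. by apply: nneseries_ge0 => n _ _; exact: after_jumps_ge0. Qed.

Lemma transition_le z : transition z <= nonneg_time z.
Proof.
apply: lime_le.
  by apply: is_cvg_nneseries => n _ _; exact: after_jumps_ge0.
by apply: nearW => n; exact: partial_sum_le.
Qed.

(** The renewal equation: either no jump has occurred, or one restarts afresh from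
    the state reached by the first jump. *)
Lemma transitionE z : transition z = no_jump z + step transition z.
Proof.
rewrite {1}/transition nneseries_recl//; last by move=> n _; exact: after_jumps_ge0.
rewrite (jump_step_nneseries gam mq q_ge0 ml z measurable_after_jumps after_jumps_ge0).
congr (_ + _).
rewrite -(@nneseries_addn _ _ 1); last by move=> n; exact: after_jumps_ge0.
by apply: eq_eseriesr => n _; rewrite addn1 -after_jumpsS.
Qed.

End transition_function.

(** * The backward equation *)

Section backward_equation.
Context d (T : measurableType d) (R : realType).
Variables (gam : R.-pker T ~> T) (q : T * T -> R) (l : T -> R).
Hypothesis mq : measurable_fun setT q.
Hypothesis q_ge0 : forall z, 0 <= q z.
Hypothesis ml : measurable_fun setT l.
Hypothesis l_gt0 : forall x, 0 < l x.
Hypothesis lE : forall x, (\int[gam x]_y (q (x, y))%:E = (l x)%:E)%E.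
Variables (A : set T) (mA : measurable A).

Local Notation V := (transition gam q l A).

Let no_jumpE t x : 0 <= t ->
  no_jump l A (t, x) = (expR (- l x * t) * \1_A x)%:E.
Proof.
move=> t0; rewrite /no_jump.
have -> : @nonneg_time _ T R (t, x) = 1%E.
  by rewrite /nonneg_time indicE mem_set//= in_itv/= t0.
by rewrite mul1e mulrC.
Qed.

Let mV : measurable_fun setT V.
Proof. exact: measurable_transition. Qed.

Let V0 z : (0 <= V z)%E.
Proof. exact: transition_ge0. Qed.

Let Vlt0 t x : t < 0 -> V (t, x) = 0%E.
Proof.
move=> t0; apply/eqP; rewrite eq_le V0 andbT.
have := transition_le mq q_ge0 ml lE mA (t, x).
by rewrite /nonneg_time indicE memNset//= in_itv/= andbT; apply/negP; rewrite -ltNge.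
Qed.

Let Vle1 z : (V z <= 1)%E.
Proof.
apply: (le_trans (transition_le mq q_ge0 ml lE mA z)).
by rewrite /nonneg_time lee_fin indicE; case: (_ \in _).
Qed.

Let Vfin z : V z \is a fin_num.
Proof. by rewrite ge0_fin_numE// (le_lt_trans (Vle1 z))// ltry. Qed.

(** The gain term [\int q(x, y) P_s(y) gam(x, dy)] of the generator. *)
Definition rate_transition (s : R) (x : T) : R := fine (rate_op gam q V (s, x)).

Let rate_op_le s x : (rate_op gam q V (s, x) <= (l x)%:E)%E.
Proof.
rewrite -lE; apply: ge0_le_integral => //.
- by move=> y _; rewrite mule_ge0// lee_fin.
- apply: emeasurable_funM; first by apply/measurable_EFinP; exact: measurableT_comp.
  exact: measurableT_comp.
- by apply/measurable_EFinP; exact: measurableT_comp.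
- by move=> y _; rewrite -[leRHS]mule1 lee_wpmul2l// lee_fin.
Qed.

Let rate_op_fin s x : rate_op gam q V (s, x) \is a fin_num.
Proof.
rewrite ge0_fin_numE; last exact: rate_op_ge0.
by rewrite (le_lt_trans (rate_op_le s x))// ltry.
Qed.

Lemma rate_transition_ge0 s x : 0 <= rate_transition s x.
Proof. by apply: fine_ge0; exact: rate_op_ge0. Qed.

Lemma rate_transition_le s x : rate_transition s x <= l x.
Proof. by rewrite -lee_fin fineK. Qed.

Let rate_transition_lt0 s x : s < 0 -> rate_op gam q V (s, x) = 0%E.
Proof.
by move=> s0; apply: integral0_eq => y _; rewrite Vlt0// mule0.
Qed.

Lemma measurable_rate_transition x : measurable_fun setT (rate_transition ^~ x).
Proof.
apply: measurableT_comp => //.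
exact: (measurableT_comp (measurable_rate_op gam mq q_ge0 mV V0) (pair2_measurable x)).
Qed.

Let integrand x s := expR (l x * s) * rate_transition s x.

Let mintegrand x : measurable_fun setT (integrand x).
Proof.
apply: measurable_funM; last exact: measurable_rate_transition.
by apply: measurableT_comp => //; exact: measurable_funM.
Qed.

Let integrand_ge0 x s : 0 <= integrand x s.
Proof. by rewrite mulr_ge0 ?expR_ge0 ?rate_transition_ge0. Qed.

Let integrand_int x a b : lebesgue_measure.-integrable `[a, b] (EFin \o integrand x).
Proof.
apply: measurable_bounded_integrable => //.
- by rewrite /= lebesgue_measure_itv/=; case: ifPn => // _; rewrite -EFinB ltry.
- by apply: measurable_funTS; exact: mintegrand.
exists (expR (l x * b) * l x); split; first exact: num_real.
move=> M hM s; rewrite /= in_itv/= => /andP[_ sb].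
rewrite ger0_norm ?integrand_ge0// (le_trans _ (ltW hM))// ler_pM ?expR_ge0 ?rate_transition_ge0 ?rate_transition_le//.
by rewrite ler_expR ler_wpM2l// ltW.
Qed.

(** The renewal equation after the substitution [s := t - r], with the
    exponential factored out: time now occurs only in that factor and in the upper
    bound of an integral, so that continuity in [t] and then differentiability can
    be read off.  For negative [t] the value is frozen at the initial one, which
    makes the function continuous on the whole line; the lower bound [-1] keeps
    [0] in the interior of the domain of integration, where the integrand
    vanishes on negative times. *)
Definition transition_prob (t : R) (x : T) : R :=
  expR (- l x * Num.max t 0) *
    (\1_A x + \int[lebesgue_measure]_(s in `[-1, t]) integrand x s).

Lemma transition_probE t x : 0 <= t -> (transition_prob t x)%:E = V (t, x).
Proof.
move=> t0; rewrite /transition_prob (max_idPl t0) (transitionE gam mq q_ge0 ml mA)//.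
rewrite mulrDr EFinD; congr (_ + _)%E.
  exact/esym/no_jumpE.
pose f (s : R) : \bar R := ((\1_(`]-oo, t]%classic : set R) s)%:E *
  ((expR (- l x * (t - s)))%:E * rate_op gam q V (s, x)))%E.
have mf : measurable_fun setT f.
  apply: emeasurable_funM; first by apply/measurable_EFinP; exact: measurable_indic.
  apply: emeasurable_funM.
    apply/measurable_EFinP; apply: measurableT_comp => //.
    by apply: measurable_funM => //; exact: measurable_funB.
  exact: (measurableT_comp (measurable_rate_op gam mq q_ge0 mV V0) (pair2_measurable x)).
have f0 s : (0 <= f s)%E.
  by rewrite mule_ge0 ?lee_fin// mule_ge0 ?lee_fin ?expR_ge0// rate_op_ge0.
transitivity (\int[lebesgue_measure]_s f s)%E; last first.
  rewrite -(ge0_integral_reflect t mf f0) /jump_step [RHS]integral_mkcond/=.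
  apply: eq_integral => r _; rewrite /f patchE indicE.
  rewrite (_ : t - (t - r) = r); last by ring.
  rewrite !mem_setE !in_itv/= andbT gerBl.
  by case: ifPn => _; rewrite ?mul1e ?mul0e.
rewrite EFinM /Rintegral fineK; last first.
  by apply: integrable_fin_num => //; exact: integrand_int.
rewrite -ge0_integralZl//; last 2 first.
- by apply/measurable_EFinP; apply: measurable_funTS; exact: mintegrand.
- by move=> s _; rewrite lee_fin.
rewrite [LHS]integral_mkcond; apply: eq_integral => s _.
rewrite patchE mem_setE in_itv/= /f indicE mem_setE in_itv/=.
have [s0|s0] := ltP s 0.
  rewrite rate_transition_lt0// !mule0; case: ifPn => // _.
  by rewrite /integrand /rate_transition rate_transition_lt0// mulr0 mule0.
rewrite (le_trans _ s0) ?lerN10//=.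
case: ifPn => _; rewrite ?mul0e// mul1e -[rate_op _ _ _ _]fineK//.
rewrite -!EFinM /integrand mulrA -expRD; congr (expR _ * _)%:E; ring.
Qed.

Lemma transition_prob_le0 t x : t <= 0 -> transition_prob t x = \1_A x.
Proof.
move=> t0; rewrite /transition_prob (max_idPr t0) mulr0 expR0 mul1r.
rewrite [X in _ + X](_ : _ = 0) ?addr0//.
rewrite -Rintegral_itv_bndo_bndc; last first.
  apply: (integrableS _ _ _ (@integrand_int x (-1) t)) => //.
  by apply: subset_itvl; rewrite bnd_simp.
rewrite /Rintegral integral0_eq// => s; rewrite /= in_itv/= => /andP[_ st].
by congr EFin; rewrite /integrand /rate_transition rate_transition_lt0 ?mulr0//; lra.
Qed.

Lemma transition_prob_ge0 t x : 0 <= transition_prob t x.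
Proof.
have [t0|t0] := leP 0 t; last first.
  by rewrite (transition_prob_le0 _ (ltW t0)) indicE ler0n.
by rewrite -lee_fin transition_probE// V0.
Qed.

Lemma transition_prob_le1 t x : transition_prob t x <= 1.
Proof.
have [t0|t0] := leP 0 t; first by rewrite -lee_fin transition_probE// Vle1.
by rewrite (transition_prob_le0 _ (ltW t0)) indicE lern1 leq_b1.
Qed.

Lemma measurable_transition_prob t : measurable_fun setT (transition_prob t).
Proof.
have [t0|t0] := leP 0 t; last first.
  rewrite (_ : transition_prob t = \1_A); first exact: measurable_indic.
  by apply/funext => x; rewrite (transition_prob_le0 _ (ltW t0)).
apply/measurable_EFinP.
rewrite (_ : _ \o _ = fun x => V (t, x)); first exact: measurableT_comp.
by apply/funext => x; rewrite /= transition_probE.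
Qed.

Let primitive x (t : R) : R := \int[lebesgue_measure]_(s in `[-1, t]) integrand x s.

Let continuous_primitive x (t : R) : -1 < t -> {for t, continuous (primitive x)}.
Proof.
move=> t1.
apply: (@within_continuous_continuous _ _ _ (-1) (t + 1)).
- by lra.
- apply: parameterized_integral_continuous; first lra.
  exact: integrand_int.
- by rewrite in_itv/= t1 ltrDl ltr01.
Qed.

Lemma continuous_transition_prob x : continuous (transition_prob ^~ x).
Proof.
move=> t; have [t1|t1] := ltP (-1) t.
  suff : {for t, continuous (fun t : R => expR (- l x * Num.max t 0) * (\1_A x + primitive x t))} by [].
  apply: continuousM.
    apply: continuous_comp; last exact: continuous_expR.
    apply: continuousM; first exact: cst_continuous.
    by apply: continuous_max => //; exact: cst_continuous.
  by apply: continuousD; [exact: cst_continuous|exact: continuous_primitive].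
apply: (@cvg_trans _ ((fun=> \1_A x) @ t)).
  apply: near_eq_cvg; near=> s; rewrite !transition_prob_le0//.
  by apply/ltW; near: s; apply: lt_nbhsl; lra.
have -> : transition_prob t x = \1_A x by apply: transition_prob_le0; lra.
by move=> B /nbhs_singleton Bx; apply: (@filterE _ (nbhs (t : R))) => s.
Unshelve. all: by end_near. Qed.

Lemma rate_transitionE s x : 0 <= s ->
  rate_transition s x = \int[gam x]_y (q (x, y) * transition_prob s y).
Proof.
move=> s0; rewrite /rate_transition /rate_op /Rintegral; congr fine.
by apply: eq_integral => y _; rewrite EFinM transition_probE.
Qed.

Let integrable_q x : (gam x).-integrable setT (EFin \o (fun y => q (x, y))).
Proof.
apply/integrableP; split; first by apply/measurable_EFinP; exact: measurableT_comp.
under eq_integral do rewrite /= ger0_norm//.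
by rewrite lE ltry.
Qed.

(** Dominated convergence: the transition function is continuous in time and
   bounded by 1, and [q (x, _)] is integrable. *)
Let continuous_rate_transition (t : R) x : 0 < t -> {for t, continuous (rate_transition ^~ x)}.
Proof.
move=> t0.
have qP s y : `|q (x, y) * transition_prob s y| <= q (x, y).
  have qp : 0 <= q (x, y) * transition_prob s y.
    by rewrite mulr_ge0// transition_prob_ge0.
  by rewrite (ger0_norm qp) ler_piMr// transition_prob_le1.
have mqP (u : R) : measurable_fun setT (fun y => q (x, y) * transition_prob u y).
  apply: measurable_funM; last exact: measurable_transition_prob.
  exact: measurableT_comp.
have H : {in (`]0, (t + 1)%R[%classic : set R),
    continuous (fun s : R => \int[gam x]_y (q (x, y) * transition_prob s y))}.
  apply: (@continuity_under_integral _ _ T (gam x) _ setT measurableT 0 (t + 1) _ _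
    (fun y => q (x, y))) => //.
  - move=> u _; apply: (le_integrable measurableT _ _ (integrable_q x)).
      exact/measurable_EFinP.
    by move=> y _; rewrite /= lee_fin (le_trans (qP u y))// ler_norm.
  - apply: aeW => y _ u _.
    suff : {for u, continuous (fun s : R => q (x, y) * transition_prob s y)} by [].
    apply: continuousM; first exact: cst_continuous.
    exact: continuous_transition_prob.
  - by move=> u _; apply: aeW => y _; exact: qP.
suff : rate_transition ^~ x @ t --> rate_transition t x by [].
rewrite (rate_transitionE _ (ltW t0)).
apply: (@cvg_trans _ ((fun s : R => \int[gam x]_y (q (x, y) * transition_prob s y)) @ t)).
  apply: near_eq_cvg; near=> s; rewrite rate_transitionE//.
  by apply/ltW; near: s; exact: lt_nbhsr.
by apply: H; rewrite inE/= in_itv/= t0 ltrDl ltr01.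
Unshelve. all: by end_near. Qed.

(** The backward equation, for each starting point separately: the exponential factor
    contributes the loss term and the integral, by the fundamental theorem of
    calculus, the gain term. *)
Lemma is_derive_transition_prob (t : R) x : 0 < t ->
  is_derive t 1 (transition_prob ^~ x)
    (rate_transition t x - l x * transition_prob t x).
Proof.
move=> t0.
have ci : {for t, continuous (integrand x)}.
  suff : {for t, continuous (fun s : R => expR (l x * s) * rate_transition s x)} by [].
  apply: continuousM; last exact: continuous_rate_transition.
  apply: continuous_comp; last exact: continuous_expR.
  by apply: continuousM => //; exact: cst_continuous.
have tt : t < t + 1 by lra.
have t1 : -1 < t by lra.
have [dI I'] := continuous_FTC1_closed tt (@integrand_int x (-1) (t + 1)) t1 ci.
have dP : is_derive t 1 (primitive x) (integrand x t).
  by apply: DeriveDef; [exact: dI|rewrite -derive1E].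
have dE : is_derive t 1 (fun s : R => expR (- l x * s)) (- l x * expR (- l x * t)).
  have dM : is_derive t 1 (fun s : R => - l x * s) (- l x).
    by apply: is_derive_eq; rewrite /GRing.scale/= ?mulr0 ?add0r ?addr0 mulr1.
  apply: is_derive_eq (is_derive1_comp (is_derive_expR (- l x * t)) dM) _.
  by rewrite mulrC.
apply: (@near_eq_is_derive _ _ _ (fun s : R => expR (- l x * s) * (\1_A x + primitive x s))).
  near=> s; rewrite /transition_prob (@max_idPl _ _ s 0 _)//.
  by apply/ltW; near: s; exact: lt_nbhsr.
apply: is_derive_eq.
rewrite /transition_prob (max_idPl (ltW t0)) -/(primitive x t).
rewrite /GRing.scale/= /integrand add0r.
have ee : expR (- l x * t) * expR (l x * t) = 1.
  by rewrite -expRD mulNr addNr expR0.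
rewrite mul1r [X in X + _]mulrA ee.
ring.
Unshelve. all: by end_near. Qed.

End backward_equation.

(** * Decay of the variance along the semigroup *)

Section decay.
Context d (T : measurableType d) (R : realType).
Variables (pi : probability T R).
Variables (gam : R.-pker T ~> T) (q : T * T -> R) (l : T -> R).
Hypothesis mq : measurable_fun setT q.
Hypothesis q_ge0 : forall z, 0 <= q z.
Hypothesis ml : measurable_fun setT l.
Hypothesis l_gt0 : forall x, 0 < l x.
Hypothesis lE : forall x, (\int[gam x]_y (q (x, y))%:E = (l x)%:E)%E.
Hypothesis il : pi.-integrable setT (EFin \o l).
Hypothesis l_inv : forall f : T -> \bar R, measurable_fun setT f ->
  (forall x, 0 <= f x)%E ->
  (\int[pi]_x \int[gam x]_y ((q (x, y))%:E * f y) = \int[pi]_x ((l x)%:E * f x))%E.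
Variables (A : set T) (mA : measurable A).

Local Notation P := (transition_prob gam q l A).
Local Notation b := (rate_transition gam q l A).

Let mP t : measurable_fun setT (P t).
Proof. exact: measurable_transition_prob. Qed.

Let P0 t x : 0 <= P t x.
Proof. exact: transition_prob_ge0. Qed.

Let P1 t x : P t x <= 1.
Proof. exact: transition_prob_le1. Qed.

Let mb t : measurable_fun setT (b t).
Proof.
apply: measurableT_comp => //.
apply: (measurableT_comp (measurable_rate_op gam mq q_ge0 _ _) (pair1_measurable t)).
- exact: measurable_transition.
- by move=> z; exact: transition_ge0.
Qed.

Let bounded_int (f : T -> R) (M : R) : measurable_fun setT f ->
  (forall x, `|f x| <= M) -> pi.-integrable setT (EFin \o f).
Proof.
move=> mf fM; apply: measurable_bounded_integrable => //.
  exact: (le_lt_trans (probability_le1 pi measurableT) (ltry _)).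
exists M; split; first exact: num_real.
by move=> N MN x _; exact: (le_trans (fM x) (ltW MN)).
Qed.

Let l_int (f : T -> R) (M : R) : measurable_fun setT f ->
  (forall x, `|f x| <= M * l x) -> pi.-integrable setT (EFin \o f).
Proof.
move=> mf fM; apply: (@le_integrable _ _ _ pi _ measurableT _ (EFin \o (fun x => M * l x))).
- exact/measurable_EFinP.
- by move=> x _; rewrite /= lee_fin (le_trans (fM x))// ler_norm.
- by under [X in _.-integrable _ X]eq_fun do rewrite EFinM; exact: integrableZl.
Qed.

(** The time derivative of [P], by the backward equation. *)
Let L t x := b t x - l x * P t x.

Let mL t : measurable_fun setT (L t).
Proof. by apply: measurable_funB => //; exact: measurable_funM. Qed.

Let L_le t x : `|L t x| <= l x.
Proof.
have b0 : 0 <= b t x by exact: rate_transition_ge0.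
have bl : b t x <= l x by exact: rate_transition_le.
have lP0 : 0 <= l x * P t x by rewrite mulr_ge0// ltW.
have lP : l x * P t x <= l x by rewrite ler_piMr// ltW.
by rewrite ler_norml /L; apply/andP; split; lra.
Qed.

Let mean t : R := \int[pi]_x P t x.
Let square_norm t : R := \int[pi]_x (P t x) ^+ 2.

Let iP t : pi.-integrable setT (EFin \o P t).
Proof. by apply: (@bounded_int _ 1) => // x; rewrite ger0_norm. Qed.

Let P2le t x : `|P t x ^+ 2| <= 1.
Proof. by rewrite ger0_norm ?exprn_ge0// exprn_ile1. Qed.

Let iP2 t : pi.-integrable setT (EFin \o (fun x => P t x ^+ 2)).
Proof. by apply: (@bounded_int _ 1) => //; exact: measurable_funX. Qed.

Let continuous_mean : continuous mean.
Proof.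
move=> t.
have H : {in (`]t - 1, t + 1[%classic : set R), continuous mean}.
  apply: (@continuity_under_integral _ _ T pi _ setT measurableT _ _ _ _ (cst 1)) => //.
  - by apply: aeW => y _ u _; exact: continuous_transition_prob.
  - by apply: (@bounded_int (cst 1) 1) => // x; rewrite normr1.
  - by move=> u _; apply: aeW => y _; rewrite ger0_norm.
by apply: H; rewrite inE/= in_itv/=; apply/andP; split; lra.
Qed.

Let continuous_square_norm : continuous square_norm.
Proof.
move=> t.
have H : {in (`]t - 1, t + 1[%classic : set R), continuous square_norm}.
  apply: (@continuity_under_integral _ _ T pi _ setT measurableT _ _ _ _ (cst 1)) => //.
  - apply: aeW => y _ u _.
    suff : {for u, continuous (fun s : R => P s y * P s y)} by [].
    by apply: continuousM; exact: continuous_transition_prob.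
  - by apply: (@bounded_int (cst 1) 1) => // x; rewrite normr1.
  - by move=> u _; apply: aeW => y _.
by apply: H; rewrite inE/= in_itv/=; apply/andP; split; lra.
Qed.

Let dP (t : R) x : 0 < t -> is_derive t 1 (P ^~ x) (L t x).
Proof. exact: is_derive_transition_prob. Qed.

Let dP2 (t : R) x : 0 < t ->
  is_derive t 1 (fun s : R => P s x ^+ 2) (2 * P t x * L t x).
Proof.
move=> t0; have := dP x t0 => H.
apply: is_derive_eq; move: (P t x) (L t x) => a c.
by rewrite /GRing.scale/=; ring.
Qed.

(** Differentiation under the integral, dominated by a multiple of the integrable
   rate [l]. *)
Let is_derive_integral (F G : R -> T -> R) (M t : R) : 0 < t -> 0 <= M ->
  (forall s, pi.-integrable setT (EFin \o F s)) ->
  (forall (s : R) x, 0 < s -> is_derive s 1 (F ^~ x) (G s x)) ->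
  (forall s x, `|G s x| <= M * l x) ->
  is_derive t 1 (fun s : R => \int[pi]_x F s x) (\int[pi]_x G t x).
Proof.
move=> t0 M0 iF dF GM.
have It : (`]0, t + 1[%classic : set R) t by rewrite /= in_itv/= t0 ltrDl ltr01.
have Ipos (s : R) : (`]0, t + 1[%classic : set R) s -> 0 < s by rewrite /= in_itv/= => /andP[].
have d1 (s : R) y : 0 < s -> partial1of2 F s y = G s y.
  by move=> s0; rewrite partial1of2E; have [_ ->] := dF _ y s0.
have derF (s : R) y : (`]0, t + 1[%classic : set R) s -> setT y -> derivable (F ^~ y) s 1.
  by move=> /Ipos s0 _; have [] := dF _ y s0.
have Ml0 y : 0 <= M * l y by rewrite mulr_ge0// ltW.
have iMl : pi.-integrable setT (EFin \o (fun x => M * l x)).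
  apply: (@l_int _ M); first exact: measurable_funM.
  by move=> x; rewrite ger0_norm.
have ub (s : R) y : (`]0, t + 1[%classic : set R) s -> setT y -> `|partial1of2 F s y| <= M * l y.
  by move=> /Ipos s0 _; rewrite d1.
have dd := @derivable_under_integral R _ T pi F setT measurableT t 0 (t + 1) It
  (fun s _ => iF s) derF _ Ml0 iMl ub.
have de := @differentiation_under_integral R _ T pi F setT measurableT t 0 (t + 1) It
  (fun s _ => iF s) derF _ Ml0 iMl ub.
apply: DeriveDef; first exact: dd.
rewrite -derive1E de; apply: eq_Rintegral => x _.
by rewrite d1.
Qed.

Let is_derive_mean (t : R) : 0 < t -> is_derive t 1 mean (\int[pi]_x L t x).
Proof.
move=> t0; apply: (@is_derive_integral _ _ 1) => //.
by move=> s x; rewrite mul1r.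
Qed.

Let is_derive_square_norm (t : R) : 0 < t ->
  is_derive t 1 square_norm (\int[pi]_x (2 * P t x * L t x)).
Proof.
move=> t0; apply: (@is_derive_integral (fun s x => P s x ^+ 2) (fun s x => 2 * P s x * L s x) 2)
  => // s x.
have := L_le s x; have := P0 s x; have := P1 s x.
move: (P s x) (L s x) => p u p1 p0 ul.
rewrite !normrM (ger0_norm p0) ger0_norm// -mulrA ler_pM2l//.
by rewrite -[leRHS]mul1r ler_pM.
Qed.

(** Stationarity of [pi]: the gain and the loss terms of the generator have the
    same finite integral. *)
Lemma integral_generator (f : T -> R) : measurable_fun setT f ->
  (forall x, 0 <= f x) -> (forall x, f x <= 1) ->
  \int[pi]_x (\int[gam x]_y (q (x, y) * f y) - l x * f x) = 0.
Proof.
move=> mf f0 f1.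
pose Qf x := \int[gam x]_y (q (x, y) * f y).
have QfE x : (Qf x)%:E = (\int[gam x]_y ((q (x, y))%:E * (f y)%:E))%E.
  rewrite /Qf /Rintegral fineK//.
  rewrite ge0_fin_numE; last first.
    by apply: integral_ge0 => y _; rewrite lee_fin mulr_ge0.
  apply: (@le_lt_trans _ _ (l x)%:E); last exact: ltry.
  rewrite -lE; apply: ge0_le_integral => //.
  - by move=> y _; rewrite lee_fin mulr_ge0.
  - apply/measurable_EFinP; apply: measurable_funM => //.
    exact: measurableT_comp.
  - by apply/measurable_EFinP; exact: measurableT_comp.
  - by move=> y _; rewrite lee_fin ler_piMr.
have mQf : measurable_fun setT Qf.
  apply/measurable_EFinP.
  rewrite (funext QfE : EFin \o Qf = _).
  apply: (measurable_integral_spker gam (f := fun z => ((q z)%:E * (f z.2)%:E)%E)).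
    apply: emeasurable_funM; first exact/measurable_EFinP.
    by apply/measurable_EFinP; exact: measurableT_comp.
  by move=> z; rewrite mule_ge0 ?lee_fin.
have Qf0 x : 0 <= Qf x.
  by apply: Rintegral_ge0 => y _; rewrite mulr_ge0.
have Qfl x : Qf x <= l x.
  rewrite -lee_fin QfE -lE; apply: ge0_le_integral => //.
  - by move=> y _; rewrite mule_ge0 ?lee_fin.
  - apply: emeasurable_funM; last exact/measurable_EFinP.
    by apply/measurable_EFinP; exact: measurableT_comp.
  - by apply/measurable_EFinP; exact: measurableT_comp.
  - by move=> y _; rewrite -EFinM lee_fin ler_piMr.
rewrite RintegralB//; last 2 first.
- by apply: (@l_int Qf 1) => // x; rewrite mul1r (ger0_norm (Qf0 x)).
- apply: (@l_int _ 1) => [|x]; first exact: measurable_funM.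
  have l0 := ltW (l_gt0 x).
  by rewrite mul1r ger0_norm ?mulr_ge0// ler_piMr.
apply/eqP; rewrite subr_eq0; apply/eqP; rewrite /Rintegral; congr fine.
under eq_integral do rewrite QfE.
rewrite l_inv//; last exact/measurable_EFinP.
Qed.

(** The derivative of the mean is the integral of the generator, hence zero.
    Applied to the whole space it says that from [pi]-almost every state the process
    does not explode. *)
Lemma mean_transition (t : R) : 0 <= t -> \int[pi]_x P t x = fine (pi A).
Proof.
move=> t0; rewrite -/(mean t).
have m0 : mean 0 = fine (pi A).
  rewrite /mean /Rintegral; congr fine.
  under eq_integral do rewrite transition_prob_le0//.
  by rewrite integral_indic// setIT.
have d0 (s : R) : 0 < s -> is_derive s 1 mean 0.
  move=> s0; apply: is_derive_eq (is_derive_mean s0) _.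
  transitivity (\int[pi]_x (\int[gam x]_y (q (x, y) * P s y) - l x * P s x)).
    by apply: eq_Rintegral => x _; rewrite /L rate_transitionE// ltW.
  exact: integral_generator.
have cm : {within `[0, t], continuous mean} by apply: continuous_subspaceT.
have dm (s : R) : s \in `]0, t[%R -> derivable mean s 1.
  by rewrite in_itv/= => /andP[/d0[]].
have dm0 (s : R) : s \in `]0, t[%R -> derive1 mean s = 0.
  by rewrite in_itv/= derive1E => /andP[/d0[]].
rewrite -m0; apply/eqP; rewrite eq_le; apply/andP; split.
  apply: (ler0_derive1_le_cc dm _ cm) => //; rewrite ?in_itv/= ?lexx ?t0//.
  by move=> s /dm0 ->.
apply: (ger0_derive1_le_cc dm _ cm) => //; rewrite ?in_itv/= ?lexx ?t0//.
by move=> s /dm0 ->.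
Qed.

Let a := fine (pi A).

Let variance_of_transition (t : R) : 0 <= t ->
  \int[pi]_x (P t x - a) ^+ 2 = square_norm t - a ^+ 2.
Proof.
move=> t0.
have -> : \int[pi]_x (P t x - a) ^+ 2 = \int[pi]_x ((P t x) ^+ 2 - (2 * a * P t x - a ^+ 2)).
  by apply: eq_Rintegral => x _; ring.
have ia : pi.-integrable setT (EFin \o (fun x => 2 * a * P t x)).
  apply: (@bounded_int _ `|2 * a|); first exact: measurable_funM.
  by move=> x; rewrite (normrM (2 * a)) ler_piMr// ger0_norm.
have ia2 : pi.-integrable setT (EFin \o (fun x : T => a ^+ 2)).
  exact: (@bounded_int _ `|a ^+ 2|).
rewrite RintegralB//; last by rewrite /comp; under eq_fun do rewrite EFinB; exact: integrableB.
rewrite RintegralB// RintegralZl// mean_transition// Rintegral_cst//.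
rewrite [X in a ^+ 2 * fine X](@probability_setT _ _ _ pi)/= -/(square_norm t) -/a; ring.
Qed.

Variable c : R.
Hypothesis poincare : forall f : T -> R, measurable_fun setT f ->
  (forall x, 0 <= f x) -> (forall x, f x <= 1) ->
  c * (\int[pi]_x (f x ^+ 2) - (\int[pi]_x f x) ^+ 2) <=
  - \int[pi]_x (f x * (\int[gam x]_y (q (x, y) * f y) - l x * f x)).

(** Gronwall: [exp (2 c s) Var(P_s)] has derivative
    [2 exp (2 c s) (c Var(P_s) + \int P_s L P_s)], which the Poincare inequality
    makes nonpositive. *)
Lemma variance_decay (t : R) : 0 <= t ->
  \int[pi]_x (P t x - a) ^+ 2 <= expR (- (2 * c * t)) * (a - a ^+ 2).
Proof.
move=> t0; rewrite variance_of_transition//.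
pose H (s : R) := expR (2 * c * s) * (square_norm s - a ^+ 2).
have H0 : H 0 = a - a ^+ 2.
  rewrite /H mulr0 expR0 mul1r; congr (_ - _).
  rewrite /square_norm /a /Rintegral; congr fine.
  under eq_integral do rewrite transition_prob_le0// expr2 -[_ * _]/((\1_A \* \1_A) _) -indicI setIid.
  by rewrite integral_indic// setIT.
have dH (s : R) : 0 < s -> is_derive s 1 H
   (expR (2 * c * s) * (2 * (c * (square_norm s - a ^+ 2) + \int[pi]_x (P s x * L s x)))).
  move=> s0.
  have dM : is_derive s 1 (fun u : R => 2 * c * u) (2 * c).
    by apply: is_derive_eq; rewrite /GRing.scale/= ?mulr0 ?add0r ?addr0 mulr1.
  have dE := is_derive1_comp (is_derive_expR (2 * c * s)) dM.
  have dS := is_derive_square_norm s0.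
  have dB : is_derive s 1 (fun u : R => square_norm u - a ^+ 2) (\int[pi]_x (2 * P s x * L s x)).
    by apply: is_derive_eq; rewrite subr0.
  have dHH : is_derive s 1 ((expR \o (fun u : R => 2 * c * u)) * (fun u : R => square_norm u - a ^+ 2)) _ := is_deriveM dE dB.
  apply: is_derive_eq dHH _.
  have -> : \int[pi]_x (2 * P s x * L s x) = 2 * \int[pi]_x (P s x * L s x).
    rewrite -RintegralZl//; first by apply: eq_Rintegral => x _; rewrite mulrA.
    apply: (@l_int _ 1) => [|x]; first exact: measurable_funM.
    have := L_le s x; have := P0 s x; have := P1 s x.
    move: (P s x) (L s x) => p u p1 p0 ul.
    by rewrite normrM (ger0_norm p0) ler_pM.
  rewrite /GRing.scale/=; ring.
have cH : continuous H.
  move=> s; suff : {for s, continuous (fun s : R => expR (2 * c * s) * (square_norm s - a ^+ 2))} by [].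
  apply: continuousM.
    apply: continuous_comp; last exact: continuous_expR.
    by apply: continuousM => //; exact: cst_continuous.
  by apply: continuousB; [exact: continuous_square_norm|exact: cst_continuous].
have HH : H t <= H 0.
  apply: (@ler0_derive1_le_cc _ H 0 t).
  - by move=> s; rewrite in_itv/= => /andP[/dH[]].
  - move=> s; rewrite in_itv/= derive1E => /andP[s0 _]; have [_ ->] := dH _ s0.
    rewrite pmulr_rle0 ?expR_gt0// pmulr_rle0//.
    have := poincare (mP s) (P0 s) (P1 s).
    rewrite -/(square_norm s) (mean_transition (ltW s0)) -/a => hp.
    rewrite (@eq_Rintegral _ _ _ pi setT (fun x => P s x * (\int[gam x]_y (q (x, y) * P s y) - l x * P s x))).
      lra.
    by move=> x _; rewrite /L rate_transitionE// ltW.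
  - exact: continuous_subspaceT.
  - by rewrite in_itv/= lexx t0.
  - by rewrite in_itv/= lexx t0.
  - exact: t0.
by rewrite -H0 expRN ler_pdivlMl ?expR_gt0//; exact: HH.
Qed.

End decay.

(** * Conditioning a chain with holding times on its history *)

Section sub_sigma_algebra.
Context d (Omega : measurableType d) (R : realType) (P : probability Omega R).
Local Open Scope ereal_scope.

(** With [h] the conditional probability of [H] given the sub-sigma-algebra generated
    by [G], the defining identity extends from events of that sub-sigma-algebra to
    its nonnegative measurable functions. *)
Lemma integral_sub_sigma (G : set (set Omega)) (H : set Omega) (h : Omega -> \bar R) :
  G `<=` measurable -> measurable H -> measurable_fun setT h ->
  (forall w, 0 <= h w) -> (forall w, h w \is a fin_num) ->
  (forall C, <<s G >> C -> P (C `&` H) = \int[P]_(w in C) h w) ->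
  forall W : g_sigma_algebraType G -> \bar R,
    measurable_fun setT W -> (forall w, 0 <= W w) ->
    \int[P]_(w in H) W w = \int[P]_w (W w * h w).
Proof.
move=> Gm mH mh h0 hfin PG W mW W0.
have sGm := smallest_sub (@sigma_algebra_measurable _ Omega) Gm.
pose phi : Omega -> g_sigma_algebraType G := id.
have mphi : measurable_fun setT phi.
  by move=> _ B mB; rewrite setTI; exact: sGm.
pose nu := pushforward (mrestr P mH) phi.
have nuP : forall A, measurable A -> nu A = \int[P]_(w in phi @^-1` A) h w.
  by move=> A mA; rewrite -PG.
rewrite -(@integral_density _ _ _ _ _ P (pushforward (mrestr P mH) phi) phi h)//.
transitivity (\int[P]_w (W w * (\1_H w)%:E)).
  rewrite integral_mkcond; apply: eq_integral => w _.
  by rewrite patchE indicE; case: ifPn => _; rewrite ?mule1 ?mule0.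
apply/esym; rewrite (@integral_density _ _ _ _ _ P (pushforward (mrestr P mH) phi) phi (fun w => (\1_H w)%:E))//.
- by apply/measurable_EFinP; exact: measurable_indic.
- move=> A mA; rewrite integral_indic//; last exact: sGm.
  by rewrite setIC.
Qed.

End sub_sigma_algebra.

Lemma pker_le1 d1 d2 (T1 : measurableType d1) (T2 : measurableType d2)
    (R : realType) (k : R.-pker T1 ~> T2) x B :
  measurable B -> (k x B <= 1)%E.
Proof.
by move=> mB; rewrite -(@prob_kernel _ _ _ _ _ k x) le_measure ?inE.
Qed.

Lemma pker_fin_num d1 d2 (T1 : measurableType d1) (T2 : measurableType d2)
    (R : realType) (k : R.-pker T1 ~> T2) x B :
  measurable B -> k x B \is a fin_num.
Proof.
by move=> mB; rewrite ge0_fin_numE// (le_lt_trans (pker_le1 k x mB))// ltry.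
Qed.

Lemma emeasurable_prod_ord d (T : measurableType d) (R : realType) n
    (h : nat -> T -> \bar R) :
  (forall k, (k < n)%N -> measurable_fun setT (h k)) ->
  measurable_fun setT (fun w => \prod_(k < n) h k w)%E.
Proof.
elim: n => [|n IH] mh.
  by under eq_fun do rewrite big_ord0; exact: measurable_cst.
under eq_fun do rewrite big_ord_recr/=.
apply: emeasurable_funM; last exact: mh.
by apply: IH => k kn; apply: mh; exact: ltnW.
Qed.

Section chain_with_holding_times.
Context (R : realType) (E : ptopologicalType).
Context d (Omega : measurableType d) (P : probability Omega R).
Variables (X : nat -> Omega -> E) (sig : nat -> Omega -> R).
Variables (K : R.-pker (borel E) ~> (borel E)) (Ex : R.-pker (borel E) ~> measurableTypeR R).
Local Open Scope ereal_scope.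
Hypothesis mX : forall n, measurable_fun setT (X n : Omega -> borel E).
Hypothesis msig : forall n, measurable_fun setT (sig n).
Hypothesis markov : forall n C (A : set (borel E)),
  chain_sigma X [set k | (k <= n)%N] C -> measurable A ->
  P (C `&` X n.+1 @^-1` A) = \int[P]_(w in C) K (X n w) A.
Hypothesis holding : forall n C (B : nat -> set R),
  chain_sigma X setT C -> (forall k, measurable (B k)) ->
  P (C `&` \bigcap_(k < n) (sig k @^-1` B k)) =
  \int[P]_(w in C) \prod_(k < n) Ex (X k w) (B k).

(** The generators of [chain_sigma], named so that the sigma-algebra can be used
    as the measurable structure of a type. *)
Definition chain_gen (I : set nat) : set (set Omega) :=
  \bigcup_(k in I) preimage_set_system setT (X k : Omega -> borel E) measurable.

Let chain_gen_measurable I : chain_gen I `<=` measurable.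
Proof.
move=> _ [k _ [A mA <-]]; exact: mX.
Qed.

Let chain_measurable I k : I k ->
  measurable_fun setT (X k : g_sigma_algebraType (chain_gen I) -> borel E).
Proof.
move=> Ik _ A mA; apply: sub_sigma_algebra; exists k => //.
by exists A.
Qed.

Let chain_sigma_preimage (I : set nat) k (A : set (borel E)) : I k -> measurable A ->
  chain_sigma X I (X k @^-1` A).
Proof. by move=> Ik mA; have := chain_measurable Ik measurableT mA; rewrite setTI. Qed.

Let markov_integral n (A : set (borel E))
    (W : g_sigma_algebraType (chain_gen [set k | (k <= n)%N]) -> \bar R) :
  measurable A -> measurable_fun setT W -> (forall w, 0 <= W w) ->
  \int[P]_(w in X n.+1 @^-1` A) W w = \int[P]_w (W w * K (X n w) A).
Proof.
move=> mA mW W0; apply: (@integral_sub_sigma _ _ _ _ (chain_gen [set k | (k <= n)%N])) => //.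
- by rewrite -[X in measurable X]setTI; exact: mX.
- exact: (measurableT_comp (measurable_kernel K A mA) (mX n)).
- by move=> w; exact: pker_fin_num.
- by move=> C sC; exact: markov sC mA.
Qed.

Let prod_Ex_ge0 n (B : nat -> set R) w : 0 <= \prod_(k < n) Ex (X k w) (B k).
Proof. by apply: prode_ge0 => k _. Qed.

Let measurable_prod_Ex n (B : nat -> set R) I : (forall k, measurable (B k)) ->
  (forall k, (k < n)%N -> I k) ->
  measurable_fun setT (fun w : g_sigma_algebraType (chain_gen I) =>
    \prod_(k < n) Ex (X k w) (B k)).
Proof.
move=> mB nI; apply: (@emeasurable_prod_ord _ (g_sigma_algebraType (chain_gen I)) _ n
  (fun k w => Ex (X k w) (B k))) => k kn.
exact: (measurableT_comp (measurable_kernel Ex (B k) (mB k)) (chain_measurable (nI _ kn))).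
Qed.

Let holding_integral n (B : nat -> set R)
    (W : g_sigma_algebraType (chain_gen setT) -> \bar R) :
  (forall k, measurable (B k)) -> measurable_fun setT W -> (forall w, 0 <= W w) ->
  \int[P]_(w in \bigcap_(k < n) (sig k @^-1` B k)) W w =
  \int[P]_w (W w * \prod_(k < n) Ex (X k w) (B k)).
Proof.
move=> mB mW W0; apply: (@integral_sub_sigma _ _ _ _ (chain_gen setT)) => //.
- apply: bigcap_measurableType => k _.
  rewrite -[X in measurable X]setTI; exact: (msig k measurableT (mB k)).
- apply: (@emeasurable_prod_ord _ Omega _ n (fun k w => Ex (X k w) (B k))) => k kn.
  exact: (measurableT_comp (measurable_kernel Ex (B k) (mB k)) (mX k)).
- move=> w; elim/big_rec : _ => // k x _ fx.
  by apply: fin_numM => //; exact: (@pker_fin_num _ _ _ _ _ Ex (X k w) (B k) (mB k)).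
- by move=> C sC; exact: holding sC mB.
Qed.

Definition arrival n w : R := \sum_(k < n) sig k w.

(** A pi-system that determines [X n] and the first [m] holding times.  Conditioning
   on [X n] alone, and not on the whole past of the chain, is enough for what
   follows since only the [m]-th arrival time and the current state matter. *)
Let history n m : set (set Omega) :=
  [set H | exists (A : set (borel E)) (B : nat -> set R),
    [/\ measurable A, forall k, measurable (B k) &
     H = X n @^-1` A `&` \bigcap_(k < m) (sig k @^-1` B k)]].

Let history_measurable n m : history n m `<=` measurable.
Proof.
move=> _ [A [B [mA mB ->]]]; apply: measurableI.
  by rewrite -[X in measurable X]setTI; exact: mX.
apply: bigcap_measurableType => k _.
rewrite -[X in measurable X]setTI; exact: (msig k measurableT (mB k)).
Qed.

Let history_setI n m : setI_closed (history n m).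
Proof.
move=> _ _ [A [B [mA mB ->]]] [A' [B' [mA' mB' ->]]].
exists (A `&` A'), (fun k => B k `&` B' k); split.
- exact: measurableI.
- by move=> k; exact: measurableI.
- by rewrite setIACA; congr (_ `&` _); rewrite -bigcapI.
Qed.

Let history_setT n m : history n m setT.
Proof.
exists setT, (fun=> setT); split => //.
rewrite preimage_setT setTI; apply/esym; rewrite -subTset => w _ k _.
by rewrite preimage_setT.
Qed.

Let history_state n m : measurable_fun setT
  (X n : g_sigma_algebraType (history n m) -> borel E).
Proof.
move=> _ A mA; rewrite setTI; apply: sub_sigma_algebra.
exists A, (fun=> setT); split => //.
by rewrite bigcapT// setIT.
Qed.

Let history_holding n m k : (k < m)%N ->
  measurable_fun setT (sig k : g_sigma_algebraType (history n m) -> R).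
Proof.
move=> km _ B mB; rewrite setTI; apply: sub_sigma_algebra.
exists setT, (fun j => if j == k then B else setT); split => //.
  by move=> j; case: ifP.
rewrite preimage_setT setTI; apply/seteqP; split => w /=.
  by move=> Bw j _; case: eqP => [->|].
by move=> /(_ k km); rewrite eqxx.
Qed.

Let history_arrival n m : measurable_fun setT
  (fun w : g_sigma_algebraType (history n m) =>
     (arrival m w, X n w) : (R * borel E)%type).
Proof.
apply: measurable_fun_pair; last exact: history_state.
by apply: measurable_sum => k; exact: history_holding.
Qed.

Let bigcap_holdingS n (B : nat -> set R) (D : set R) :
  \bigcap_(k < n) (sig k @^-1` B k) `&` sig n @^-1` D =
  \bigcap_(k < n.+1) (sig k @^-1` (if (k < n)%N then B k else D)).
Proof.
apply/seteqP; split => w.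
  move=> [HB HD] k /=; rewrite ltnS leq_eqVlt => /predU1P[->|kn].
    by rewrite ltnn.
  by rewrite kn; exact: HB.
move=> H; split.
  by move=> k /= kn; have := H k (ltnW kn : (k < n.+1)%N); rewrite kn.
by have := H n (ltnSn n); rewrite ltnn.
Qed.

(** Both sides are integrals over the chain of products of exponential laws: the
   last factor of the product over [k < n.+1] is the law of [sig n]. *)
Let holding_rect n H (D : set R) : history n n H -> measurable D ->
  P (H `&` sig n @^-1` D) = \int[P]_(w in H) Ex (X n w) D.
Proof.
move=> [A [B [mA mB ->]]] mD.
have mXA : measurable (X n @^-1` A).
  by rewrite -[X in measurable X]setTI; exact: mX.
have mB' k : measurable (if (k < n)%N then B k else D) by case: ifP.
rewrite -setIA bigcap_holdingS holding//; last exact: chain_sigma_preimage.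
pose W w := (\1_A (X n w))%:E * Ex (X n w) D.
have mW : measurable_fun setT (W : g_sigma_algebraType (chain_gen setT) -> \bar R).
  apply: emeasurable_funM.
    apply/measurable_EFinP.
    apply: (@measurableT_comp _ _ _ _ _ _ (\1_A : borel E -> R)).
      exact: measurable_indic.
    exact: chain_measurable.
  exact: (measurableT_comp (measurable_kernel Ex D mD) (chain_measurable (I : setT n))).
have W0 w : 0 <= W w by rewrite mule_ge0 ?lee_fin.
transitivity (\int[P]_w (W w * \prod_(k < n) Ex (X k w) (B k))).
  rewrite integral_mkcond; apply: eq_integral => w _.
  rewrite patchE big_ord_recr/= ltnn /W indicE.
  rewrite (_ : (X n w \in A) = (w \in X n @^-1` A))//.
  case: ifPn => _; rewrite ?mul0e// mul1e muleC; congr (_ * _).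
  by apply: eq_bigr => k _; rewrite ltn_ord.
rewrite -holding_integral// [LHS]integral_mkcond [RHS]integral_mkcond.
apply: eq_integral => w _; rewrite !patchE in_setI /W indicE.
rewrite (_ : (X n w \in A) = (w \in X n @^-1` A))//.
by case: (w \in X n @^-1` A) => /=; case: ifP => // _; rewrite ?mul1e ?mul0e.
Qed.

(** First integrate out the holding times given the whole chain, then apply the
   Markov property to the resulting function of [X 0, ..., X n], and undo the first
   step. *)
Let markov_rect n H (A' : set (borel E)) : history n n.+1 H -> measurable A' ->
  P (H `&` X n.+1 @^-1` A') = \int[P]_(w in H) K (X n w) A'.
Proof.
move=> [A [B [mA mB ->]]] mA'.
rewrite setIAC holding//; last first.
  apply: (@measurableI _ (g_sigma_algebraType (chain_gen setT)));
    exact: chain_sigma_preimage.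
pose W w := (\1_A (X n w))%:E * K (X n w) A'.
have mW : measurable_fun setT (W : g_sigma_algebraType (chain_gen setT) -> \bar R).
  apply: emeasurable_funM.
    apply/measurable_EFinP.
    apply: (@measurableT_comp _ _ _ _ _ _ (\1_A : borel E -> R)).
      exact: measurable_indic.
    exact: chain_measurable.
  exact: (measurableT_comp (measurable_kernel K A' mA') (chain_measurable (I : setT n))).
have W0 w : 0 <= W w by rewrite mule_ge0 ?lee_fin.
pose V w := (\1_A (X n w))%:E * \prod_(k < n.+1) Ex (X k w) (B k).
have nn : [set k | (k <= n)%N] n by rewrite /=.
have mV : measurable_fun setT
    (V : g_sigma_algebraType (chain_gen [set k | (k <= n)%N]) -> \bar R).
  apply: emeasurable_funM.
    apply/measurable_EFinP.
    apply: (@measurableT_comp _ _ _ _ _ _ (\1_A : borel E -> R)).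
      exact: measurable_indic.
    exact: chain_measurable.
  exact: measurable_prod_Ex.
have V0 w : 0 <= V w by rewrite mule_ge0 ?lee_fin.
transitivity (\int[P]_(w in X n.+1 @^-1` A') V w).
  rewrite [LHS]integral_mkcond [RHS]integral_mkcond.
  apply: eq_integral => w _; rewrite !patchE in_setI /V indicE.
  rewrite (_ : (X n w \in A) = (w \in X n @^-1` A))//.
  by case: (w \in X n @^-1` A) => /=; case: ifP => // _; rewrite ?mul1e ?mul0e.
rewrite markov_integral//.
transitivity (\int[P]_w (W w * \prod_(k < n.+1) Ex (X k w) (B k))).
  by apply: eq_integral => w _; rewrite /V /W muleAC.
rewrite -holding_integral// [LHS]integral_mkcond [RHS]integral_mkcond.
apply: eq_integral => w _; rewrite !patchE in_setI /W indicE.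
rewrite (_ : (X n w \in A) = (w \in X n @^-1` A))//.
by case: (w \in X n @^-1` A) => /=; case: ifP => // _; rewrite ?mul1e ?mul0e.
Qed.

Lemma integral_holding n (F : (R * borel E) * measurableTypeR R -> \bar R) :
  measurable_fun setT F -> (forall z, 0 <= F z) ->
  \int[P]_w F ((arrival n w, X n w), sig n w) =
  \int[P]_w \int[Ex (X n w)]_u F ((arrival n w, X n w), u).
Proof.
move=> mF F0.
apply: (@integral_conditional _ _ _ _ _ (measurableTypeR R) _ P
  (fun w => (arrival n w, X n w): (R * borel E)%type)
  (sig n : Omega -> measurableTypeR R) (kernel.kernel_snd Ex) (history n n)) => //.
- by move=> C mC; have := @history_arrival n n measurableT C mC; rewrite setTI.
- exact: (msig n).
- by move=> H B HH mB; exact: holding_rect.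
Qed.

Lemma integral_markov n (F : (R * borel E) * borel E -> \bar R) :
  measurable_fun setT F -> (forall z, 0 <= F z) ->
  \int[P]_w F ((arrival n.+1 w, X n w), X n.+1 w) =
  \int[P]_w \int[K (X n w)]_y F ((arrival n.+1 w, X n w), y).
Proof.
move=> mF F0.
apply: (@integral_conditional _ _ _ _ _ _ _ P (fun w => (arrival n.+1 w, X n w): (R * borel E)%type)
  (X n.+1 : Omega -> borel E) (kernel.kernel_snd K) (history n n.+1)) => //.
- by move=> C mC; have := @history_arrival n n.+1 measurableT C mC; rewrite setTI.
- by move=> H B HH mB; exact: markov_rect.
Qed.

End chain_with_holding_times.

(** * The law of the state of a chain with exponential holding times *)

Section bundled_kernel.
Context d1 d2 (T1 : measurableType d1) (T2 : measurableType d2) (R : realType).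
Variable m : T1 -> {measure set T2 -> \bar R}.

(** A family of measures packed with the proofs that make it a probability kernel,
    so that the kernel structures below can be inferred. *)
Definition pker_of
  (mm : forall B, measurable B -> measurable_fun setT (m ^~ B))
  (m1 : forall x, m x setT = 1%E) : T1 -> {measure set T2 -> \bar R} := m.

Variables (mm : forall B, measurable B -> measurable_fun setT (m ^~ B))
  (m1 : forall x, m x setT = 1%E).

HB.instance Definition _ := isKernel.Build _ _ _ _ R (pker_of mm m1) mm.
HB.instance Definition _ := Kernel_isProbability.Build _ _ _ _ _ (pker_of mm m1) m1.

End bundled_kernel.

Section kernels.
Context d (T : measurableType d) (R : realType).
Variables (gam : R.-pker T ~> T) (q : T * T -> R) (l : T -> R).
Hypothesis mq : measurable_fun setT q.
Hypothesis q_ge0 : forall z, 0 <= q z.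
Hypothesis ml : measurable_fun setT l.
Hypothesis l_gt0 : forall x, 0 < l x.
Hypothesis lE : forall x, (\int[gam x]_y (q (x, y))%:E = (l x)%:E)%E.
Local Open Scope ereal_scope.

Let mpdf x : measurable_fun setT (fun r => (exponential_pdf (l x) r)%:E).
Proof. by apply/measurable_EFinP; exact: measurable_exponential_pdf. Qed.

Let pdf_ge0 x r : 0 <= (exponential_pdf (l x) r)%:E.
Proof. by rewrite lee_fin exponential_pdf_ge0// ltW. Qed.

Definition exp_measure x : {measure set (measurableTypeR R) -> \bar R} :=
  mdensity (@lebesgue_measure R) (mpdf x) (pdf_ge0 x).

Let measurable_exp_measure B : measurable B -> measurable_fun setT (exp_measure ^~ B).
Proof.
move=> mB.
pose k (w : T * R) := (\1_B w.2)%:E * (\1_(`[0%R, +oo[%classic : set R) w.2)%:E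
  * (l w.1 * expR (- l w.1 * w.2))%:E.
rewrite (_ : exp_measure ^~ B = fubini_F (@lebesgue_measure R) k); last first.
  apply/funext => x; rewrite /exp_measure /= /mdensity /fubini_F [LHS]integral_mkcond.
  apply: eq_integral => r _; rewrite /k /= !patchE !indicE.
  case: (r \in B); rewrite ?mul0e// mul1e /exponential_pdf patchE.
  by case: ifPn => _; rewrite ?mul0e// mul1e.
apply: measurable_fun_fubini_tonelli_F; last first.
  move=> w; rewrite /k mule_ge0//.
  by rewrite lee_fin mulr_ge0 ?expR_ge0// ltW.
apply: emeasurable_funM.
  apply: emeasurable_funM.
    by apply/measurable_EFinP; apply: measurableT_comp => //; exact: measurable_indic.
  by apply/measurable_EFinP; apply: measurableT_comp.
apply/measurable_EFinP; apply: measurable_funM; first exact: measurableT_comp.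
apply: measurableT_comp => //; apply: measurable_funM => //.
by apply: measurableT_comp => //; exact: measurableT_comp.
Qed.

Let exp_measureT x : exp_measure x setT = 1.
Proof. by rewrite /exp_measure /= /mdensity integral_exponential_pdf. Qed.

Definition exp_kernel : R.-pker T ~> measurableTypeR R := pker_of measurable_exp_measure exp_measureT.

Let mjump x : measurable_fun setT (fun y => (q (x, y) / l x)%:E).
Proof.
apply/measurable_EFinP; apply: measurable_funM => //.
exact: measurableT_comp.
Qed.

Let jump_ge0 x y : 0 <= (q (x, y) / l x)%:E.
Proof. by rewrite lee_fin divr_ge0// ltW. Qed.

Definition jump_measure x : {measure set T -> \bar R} :=
  mdensity (gam x) (mjump x) (jump_ge0 x).

Let measurable_jump_measure B : measurable B -> measurable_fun setT (jump_measure ^~ B).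
Proof.
move=> mB.
pose k (w : T * T) := (\1_B w.2)%:E * (q w * (l w.1)^-1)%:E.
rewrite (_ : jump_measure ^~ B = fun x => \int[gam x]_y k (x, y)); last first.
  apply/funext => x; rewrite /jump_measure /= /mdensity [LHS]integral_mkcond.
  apply: eq_integral => r _; rewrite /k /= patchE indicE.
  by case: ifPn => _; rewrite ?mul0e// mul1e.
apply: (measurable_integral_spker gam); last first.
  by move=> w; rewrite /k mule_ge0 ?lee_fin// divr_ge0// ltW.
apply: emeasurable_funM.
  by apply/measurable_EFinP; apply: measurableT_comp => //; exact: measurable_indic.
apply/measurable_EFinP; apply: measurable_funM => //.
rewrite (_ : (fun w : T * T => (l w.1)^-1%R) = fun w => expR (- ln (l w.1))).
  apply: measurableT_comp => //; apply: measurable_funN.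
  by apply: measurableT_comp => //; exact: measurableT_comp.
by apply/funext => w; rewrite expRN lnK// posrE.
Qed.

Let jump_measureT x : jump_measure x setT = 1.
Proof.
rewrite /jump_measure /= /mdensity; under eq_integral do rewrite EFinM muleC.
rewrite ge0_integralZl//.
- by rewrite [X in _ * X]lE -EFinM mulVf// gt_eqF.
- by apply/measurable_EFinP; exact: measurableT_comp.
- by move=> y _; rewrite lee_fin.
- by rewrite lee_fin invr_ge0 ltW.
Qed.

Definition jump_kernel : R.-pker T ~> T :=
  pker_of measurable_jump_measure jump_measureT.

Lemma integral_exp_kernel x f : measurable_fun setT f -> (forall u, 0 <= f u) ->
  \int[exp_kernel x]_u f u =
  \int[lebesgue_measure]_(r in `[0%R, +oo[) ((l x * expR (- l x * r))%:E * f r).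
Proof.
move=> mf f0.
rewrite (@integral_density _ _ _ _ _ (@lebesgue_measure R) (exp_kernel x) id
  (fun r => (exponential_pdf (l x) r)%:E))//.
rewrite [RHS]integral_mkcond; apply: eq_integral => r _.
rewrite patchE /exponential_pdf patchE; case: ifPn => _; last by rewrite mule0.
  by rewrite muleC.
exact: mpdf.
Qed.

Lemma integral_jump_kernel x f : measurable_fun setT f -> (forall u, 0 <= f u) ->
  (l x)%:E * \int[jump_kernel x]_y f y = \int[gam x]_y ((q (x, y))%:E * f y).
Proof.
move=> mf f0.
rewrite (@integral_density _ _ _ _ _ (gam x) (jump_kernel x) id
  (fun y => (q (x, y) / l x)%:E))//.
rewrite -ge0_integralZl//.
- apply: eq_integral => y _.
  rewrite muleCA -EFinM mulrCA mulfV ?mulr1 ?gt_eqF// muleC//.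
- by apply: emeasurable_funM.
- by move=> y _; rewrite mule_ge0.
- by rewrite lee_fin ltW.
Qed.

(** The link between [jump_step], which is suited to differentiation, and the kernels
    that describe the process. *)
Lemma jump_stepE F z : measurable_fun setT F -> (forall z, 0 <= F z) ->
  jump_step gam q l F z =
  \int[exp_kernel z.2]_u \int[jump_kernel z.2]_y F ((z.1 - u)%R, y).
Proof.
move=> mF F0.
have mG : measurable_fun setT (fun w : R * T => \int[jump_kernel w.2]_y F (w.1, y)).
  apply: (measurable_fun_integral_finite_kernel
    (fun w : (R * T) * T => F (w.1.1, w.2)) (kernel.kernel_snd jump_kernel)) => //.
  apply: (measurableT_comp mF); apply: measurable_fun_pair => //.
  exact: measurableT_comp.
rewrite integral_exp_kernel; last 2 first.
- apply: (measurableT_comp mG (_ : measurable_fun setT (fun u : R => ((z.1 - u)%R, z.2)))).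
  apply: measurable_fun_pair => //; exact: measurable_funB.
- by move=> u; exact: integral_ge0.
apply: eq_integral => r _; rewrite (mulrC (l z.2)) EFinM -muleA; congr (_ * _).
rewrite [RHS]integral_jump_kernel//.
exact: measurableT_comp.
Qed.

Lemma exp_kernel_tail x (a : R) : (0 <= a)%R ->
  exp_kernel x `]a, +oo[%classic = (expR (- l x * a))%:E.
Proof.
move=> a0.
have mI : measurable (`]a, +oo[%classic : set (measurableTypeR R)).
  exact: (measurable_itv `]a, +oo[).
have E : exp_kernel x (~` `]a, +oo[%classic) = 1 - (expR (- l x * a))%:E.
  transitivity (\int[lebesgue_measure]_(r in `[0%R, a]) (exponential_pdf (l x) r)%:E).
    rewrite [LHS]integral_mkcond [RHS]integral_mkcond; apply: eq_integral => r _.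
    rewrite !patchE in_setC !mem_setE !in_itv/= andbT -leNgt.
    rewrite /exponential_pdf patchE mem_setE in_itv/= andbT.
    by have [r0|r0] := leP 0%R r; case: ifP.
  move: a0; rewrite le_eqVlt => /predU1P[<-|a1].
    by rewrite set_itv1 integral_set1 mulr0 expR0 subee.
  exact: exponential_prob_itv0c.
have U : 1 = exp_kernel x `]a, +oo[%classic + (1 - (expR (- l x * a))%:E).
  rewrite -E -(measureU (exp_kernel x) mI (measurableC mI) (setICr _)) setUv.
  exact/esym/(@prob_kernel _ _ _ _ _ exp_kernel x).
move: U; have := @pker_fin_num _ _ _ _ _ exp_kernel x _ mI.
move: (exp_kernel x `]a, +oo[%classic) => [r| |]//= _.
by rewrite -EFinB -EFinD => -[]; move: (expR _) => e H; congr EFin; lra.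
Qed.

End kernels.

Section embedded_chain.
Context (R : realType) (E : ptopologicalType).
Context d (Omega : measurableType d) (P : probability Omega R).
Variables (X : nat -> Omega -> E) (sig : nat -> Omega -> R).
Variables (gam : R.-pker (borel E) ~> (borel E)) (q : borel E * borel E -> R) (l : borel E -> R).
Hypothesis mq : measurable_fun setT q.
Hypothesis q_ge0 : forall z, (0 <= q z)%R.
Hypothesis ml : measurable_fun setT l.
Hypothesis l_gt0 : forall x, (0 < l x)%R.
Hypothesis lE : forall x, (\int[gam x]_y (q (x, y))%:E = (l x)%:E)%E.
Local Open Scope ereal_scope.
Hypothesis mX : forall n, measurable_fun setT (X n : Omega -> borel E).
Hypothesis msig : forall n, measurable_fun setT (sig n).
Local Notation K := (jump_kernel mq q_ge0 ml l_gt0 lE).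
Local Notation Ex := (exp_kernel ml l_gt0).
Hypothesis markov : forall n C (A : set (borel E)),
  chain_sigma X [set k | (k <= n)%N] C -> measurable A ->
  P (C `&` X n.+1 @^-1` A) = \int[P]_(w in C) K (X n w) A.
Hypothesis holding : forall n C (B : nat -> set R),
  chain_sigma X setT C -> (forall k, measurable (B k)) ->
  P (C `&` \bigcap_(k < n) (sig k @^-1` B k)) =
  \int[P]_(w in C) \prod_(k < n) Ex (X k w) (B k).

Local Notation S := (arrival sig).

Let arrivalS n w : S n.+1 w = (S n w + sig n w)%R.
Proof. by rewrite /arrival big_ord_recr. Qed.

Let marrival n : measurable_fun setT (S n).
Proof. by apply: measurable_sum. Qed.

(** One step of the strategy: integrate out [X n.+1] by the Markov property, then
    [sig n] by its exponential law. *)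
Lemma integral_next_jump n (s : R) (F : R * borel E -> \bar R) :
  measurable_fun setT F -> (forall z, 0 <= F z) ->
  \int[P]_w F ((s - S n.+1 w)%R, X n.+1 w) =
  \int[P]_w jump_step gam q l F ((s - S n w)%R, X n w).
Proof.
move=> mF F0.
pose G (z : R * borel E) := \int[K z.2]_y F (z.1, y).
have mG : measurable_fun setT G.
  apply: (measurable_fun_integral_finite_kernel
    (fun w : (R * borel E) * borel E => F (w.1.1, w.2)) (kernel.kernel_snd K)) => //.
  apply: (measurableT_comp mF); apply: measurable_fun_pair => //.
  exact: measurableT_comp.
have G0 z : 0 <= G z by exact: integral_ge0.
rewrite (@integral_markov _ _ _ _ _ X sig K Ex mX msig markov holding n
  (fun z => F ((s - z.1.1)%R, z.2)))//; last first.
  apply: (measurableT_comp mF); apply: measurable_fun_pair => //.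
  apply: measurable_funB => //; exact: measurableT_comp.
transitivity (\int[P]_w G ((s - S n w - sig n w)%R, X n w)).
  by apply: eq_integral => w _; rewrite /G arrivalS /= opprD addrA.
rewrite (@integral_holding _ _ _ _ _ X sig Ex mX msig holding n
  (fun z => G ((s - z.1.1 - z.2)%R, z.1.2)))//.
- by apply: eq_integral => w _; rewrite (jump_stepE mq q_ge0 ml l_gt0 lE).
- apply: (measurableT_comp mG); apply: measurable_fun_pair.
    apply: measurable_funB => //; apply: measurable_funB => //.
    exact: measurableT_comp.
  exact: measurableT_comp.
Qed.

Variables (A : set (borel E)) (mA : measurable A).

Lemma integral_after_jumps n m (s : R) :
  \int[P]_w after_jumps gam q l A m ((s - S n w)%R, X n w) =
  \int[P]_w after_jumps gam q l A (n + m) (s, X 0%N w).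
Proof.
elim: n m => [|n IH] m.
  apply: eq_integral => w _; rewrite add0n; congr (after_jumps _ _ _ _ _ (_, _)).
  by rewrite /arrival big_ord0 subr0.
rewrite integral_next_jump.
- by rewrite -after_jumpsS IH addSnnS.
- exact: measurable_after_jumps.
- exact: after_jumps_ge0.
Qed.

(** Integrating out the last holding time, which must exceed the time left, gives
    [no_jump]; the earlier jumps are then undone one by one. *)
Lemma prob_state_after_jumps n (s : R) :
  P [set w | [/\ A (X n w), (S n w <= s)%R & (s < S n.+1 w)%R]] =
  \int[P]_w after_jumps gam q l A n (s, X 0%N w).
Proof.
rewrite -[in RHS](addn0 n) -integral_after_jumps.
pose F (z : (R * borel E) * measurableTypeR R) : \bar R :=
  (\1_A z.1.2 * \1_(`]-oo, s]%classic : set R) z.1.1 *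
   \1_(`]s, +oo[%classic : set R) (z.1.1 + z.2)%R)%:E.
have mF : measurable_fun setT F.
  apply/measurable_EFinP; apply: measurable_funM.
    apply: measurable_funM.
      apply: (@measurableT_comp _ _ _ _ _ _ (\1_A : borel E -> R)).
        exact: measurable_indic.
      exact: measurableT_comp.
    by apply: measurableT_comp => //; exact: measurableT_comp.
  apply: measurableT_comp => //; apply: measurable_funD => //.
  exact: measurableT_comp.
have F0 z : 0 <= F z by rewrite lee_fin !mulr_ge0.
have mE : measurable [set w | [/\ A (X n w), (S n w <= s)%R & (s < S n.+1 w)%R]].
  rewrite (_ : [set w | _] = (X n @^-1` A) `&` (S n @^-1` `]-oo, s]) `&`
      (S n.+1 @^-1` `]s, +oo[)); last first.
    apply/seteqP; split => w /=; rewrite !in_itv/= andbT; first by case.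
    by move=> [[? ?] ?].
  apply: measurableI; last by rewrite -[X in measurable X]setTI; exact: marrival.
  apply: measurableI; first by rewrite -[X in measurable X]setTI; exact: mX.
  by rewrite -[X in measurable X]setTI; exact: marrival.
transitivity (\int[P]_w F ((S n w, X n w), sig n w)).
  rewrite -[LHS]/(P _) -[X in P X]setIT -integral_indic//.
  apply: eq_integral => w _; rewrite /F /= !indicE -!natrM !mulnb; congr (nat_of_bool _)%:R%:E.
  rewrite !mem_setE !in_itv/= andbT -arrivalS.
  apply/idP/idP; first by rewrite inE /= => -[AX -> ->]; rewrite (mem_set AX).
  by move=> /andP[/andP[/set_mem AX ? ?]]; rewrite inE.
rewrite (@integral_holding _ _ _ _ _ X sig Ex mX msig holding n F)//.
apply: eq_integral => w _.
rewrite -[after_jumps _ _ _ _ _ _]/(no_jump l A ((s - S n w)%R, X n w)).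
pose c : R := (\1_A (X n w) * \1_(`]-oo, s]%classic : set R) (S n w))%R.
have mI : measurable (`](s - S n w)%R, +oo[%classic : set (measurableTypeR R)).
  exact: (measurable_itv `]_, +oo[).
transitivity (\int[Ex (X n w)]_u (c%:E * (\1_(`](s - S n w)%R, +oo[%classic) u)%:E)).
  apply: eq_integral => u _; rewrite /F -EFinM; congr (c * _)%:E.
  by rewrite !indicE !mem_setE !in_itv/= !andbT ltrBlDl.
rewrite ge0_integralZl//.
- rewrite integral_indic// setIT /no_jump /nonneg_time /c/= !indicE !mem_setE !in_itv/= andbT subr_ge0.
  have [Ss|Ss] := leP (S n w) s; last by rewrite mulr0 !mul0e.
  by rewrite exp_kernel_tail ?subr_ge0// mulr1 mul1e EFinM.
- by apply/measurable_EFinP; exact: measurable_indic.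
- by rewrite lee_fin mulr_ge0.
Qed.

Lemma prob_state_transition (s : R) :
  \sum_(0 <= n <oo)
    P [set w | [/\ A (X n w), (S n w <= s)%R & (s < S n.+1 w)%R]] =
  \int[P]_w transition gam q l A (s, X 0%N w).
Proof.
under eq_eseriesr do rewrite prob_state_after_jumps.
rewrite -integral_nneseries//.
- move=> n; apply: (measurableT_comp (measurable_after_jumps gam mq q_ge0 ml mA n)).
  by apply: measurable_fun_pair.
- by move=> n w _; exact: after_jumps_ge0.
Qed.

End embedded_chain.

(** * The law of the jump process *)

Section jump_process_law.
Context (R : realType) (E : ptopologicalType).
Context d (Omega : measurableType d) (P : probability Omega R).
Variables (X : nat -> Omega -> E) (tau : nat -> Omega -> \bar R).
Variables (pi mu : probability (borel E) R).
Variables (lam : E -> \bar R) (Gam : E -> set (borel E) -> \bar R).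
Variables (gam : R.-pker (borel E) ~> (borel E)) (q : borel E * borel E -> R) (l : borel E -> R).
Hypothesis mq : measurable_fun setT q.
Hypothesis q_ge0 : forall z, (0 <= q z)%R.
Hypothesis ml : measurable_fun setT l.
Hypothesis l_gt0 : forall x, (0 < l x)%R.
Hypothesis lE : forall x, (\int[gam x]_y (q (x, y))%:E = (l x)%:E)%E.
Local Open Scope ereal_scope.
Hypothesis l_inv : forall f : borel E -> \bar R, measurable_fun setT f ->
  (forall x, 0 <= f x) ->
  \int[pi]_x \int[gam x]_y ((q (x, y))%:E * f y) = \int[pi]_x ((l x)%:E * f x).
Hypothesis mlam : measurable_fun setT (lam : borel E -> \bar R).

(** States where the embedded kernel stays put and the holding time is 0 or
    infinite. *)
Definition degenerate : set (borel E) := [set x | lam x = 0 \/ lam x = +oo].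

Hypothesis lam_good : forall x, ~ degenerate x -> lam x = (l x)%:E.
Hypothesis Gam_good : forall x (A : set (borel E)), ~ degenerate x ->
  Gam x A = \int[gam x]_(y in A) (q (x, y) / l x)%:E.
Hypothesis Gam_bad : forall x (A : set (borel E)), degenerate x -> Gam x A = \d_(x : borel E) A.
Hypothesis pi_degenerate : pi degenerate = 0.
Hypothesis mu_pi : mu `<< pi.
Hypothesis J : is_jump_process X tau lam Gam mu P.

Local Notation K := (jump_kernel mq q_ge0 ml l_gt0 lE).
Local Notation Ex := (exp_kernel ml l_gt0).

Let mX n : measurable_fun setT (X n : Omega -> borel E).
Proof. exact: (Defs.chain_measurable J). Qed.

Let mtau n : measurable_fun setT (tau n).
Proof. exact: holding_measurable J n. Qed.

Lemma measurable_degenerate : measurable degenerate.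
Proof.
rewrite (_ : degenerate = (lam @^-1` [set 0]) `|` (lam @^-1` [set +oo%E])); last by [].
by apply: measurableU; rewrite -[X in measurable X]setTI; apply: mlam.
Qed.

Let mdeg := measurable_degenerate.

Let preimX n (B : set (borel E)) : measurable B -> measurable (X n @^-1` B).
Proof. by move=> mB; rewrite -[X in measurable X]setTI; exact: mX. Qed.

Let GamE (A : set (borel E)) : Gam ^~ A = fun x : borel E =>
  (\1_degenerate x)%:E * (\1_A x)%:E + (\1_(~` degenerate) x)%:E * K x A.
Proof.
apply/funext => x; rewrite !indicE in_setC.
case: (pselect (degenerate x)) => [dx|ndx].
  by rewrite (mem_set dx) mul1e mul0e adde0 Gam_bad.
by rewrite (memNset ndx) mul1e mul0e add0e Gam_good.
Qed.

Let mGam (A : set (borel E)) : measurable A ->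
  measurable_fun setT (Gam ^~ A : borel E -> \bar R).
Proof.
move=> mA; rewrite GamE; apply: emeasurable_funD.
  by apply: emeasurable_funM; apply/measurable_EFinP; exact: measurable_indic.
apply: emeasurable_funM; last exact: measurable_kernel.
by apply/measurable_EFinP; apply: measurable_indic; exact: measurableC.
Qed.

(** Stationarity for the indicator of [B]: the integral of [l x * K x B] over [pi] is
   the integral of [l] over [B]. *)
Let K_null (B : set (borel E)) : measurable B -> pi B = 0 ->
  pi [set x | K x B != 0] = 0.
Proof.
move=> mB B0.
have mKB : measurable_fun setT (fun x : borel E => K x B) by exact: measurable_kernel.
have m1B : measurable_fun setT (fun x : borel E => (\1_B x)%:E : \bar R).
  by apply/measurable_EFinP; exact: measurable_indic.
have mf : measurable_fun setT (fun x : borel E => (l x)%:E * K x B).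
  by apply: emeasurable_funM => //; exact/measurable_EFinP.
have KB x : (l x)%:E * K x B = \int[gam x]_y ((q (x, y))%:E * (\1_B y)%:E).
  rewrite -(integral_jump_kernel mq q_ge0 ml l_gt0 lE x m1B)//.
  by rewrite integral_indic// setIT.
have : \int[pi]_x `|(l x)%:E * K x B| = 0.
  transitivity (\int[pi]_x ((l x)%:E * (\1_B x)%:E)).
    rewrite -l_inv//; apply: eq_integral => x _.
    have nn : 0 <= (l x)%:E * K x B by rewrite mule_ge0// lee_fin ltW.
    by rewrite (gee0_abs nn) KB.
  transitivity (\int[pi]_(x in B) (l x)%:E).
    rewrite [RHS]integral_mkcond; apply: eq_integral => x _.
    by rewrite patchE indicE; case: ifPn => _; rewrite ?mule1 ?mule0.
  apply: null_set_integral => //.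
  by apply/measurable_EFinP; exact: measurable_funTS.
move/(ae_eq_integral_abs pi measurableT mf) => [N [mN N0 NS]].
apply/eqP; rewrite eq_le measure_ge0 andbT -[leRHS]N0 le_measure ?inE//.
  by rewrite -[X in measurable X]setTI; exact: emeasurable_neq.
move=> x /= Kx; apply: NS => /= /(_ Logic.I) /eqP.
by rewrite mule_eq0 (negbTE Kx) orbF eqe gt_eqF.
Qed.

(** Every [X n] inherits absolute continuity from the initial law; in particular the
   chain avoids the degenerate states. *)
Let law_null n (B : set (borel E)) : measurable B -> pi B = 0 -> P (X n @^-1` B) = 0.
Proof.
elim: n B => [|n IH] B mB B0.
  rewrite (chain_init J)//.
  by have /null_content_dominatesP := mu_pi; apply.
have mN : measurable [set x : borel E | K x B != 0].
  by rewrite -[X in measurable X]setTI; apply: emeasurable_neq => //; exact: measurable_kernel.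
have D0 : P (X n @^-1` (degenerate `|` [set x : borel E | K x B != 0])) = 0.
  apply: IH; first exact: measurableU.
  apply/eqP; rewrite eq_le measure_ge0 andbT.
  apply: (le_trans (measureU2 _ _ _)) => //.
  by rewrite [X in X + _]pi_degenerate [X in _ + X](K_null mB B0) adde0.
have -> : X n.+1 @^-1` B = setT `&` X n.+1 @^-1` B by rewrite setTI.
rewrite (chain_markov J)//; last exact: (@measurableT _ (g_sigma_algebraType _)).
rewrite (_ : 0 = \int[P]_w cst 0 w); last by rewrite integral0.
apply: ae_eq_integral => //.
  exact: (measurableT_comp (mGam mB) (mX n)).
exists (X n @^-1` (degenerate `|` [set x : borel E | K x B != 0])); split => //.
  by apply: preimX; exact: measurableU.
move=> w /= H; apply: contrapT => /not_orP [nd /negP]; rewrite negbK => /eqP K0.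
apply: H => _; rewrite Gam_good//.
Qed.

Let chain_sigma_measurable I C : chain_sigma X I C -> measurable C.
Proof.
apply: smallest_sub; first exact: sigma_algebra_measurable.
by move=> _ [k _ [A mA <-]]; exact: mX.
Qed.

Let markov_regular n C (A : set (borel E)) :
  chain_sigma X [set k | (k <= n)%N] C -> measurable A ->
  P (C `&` X n.+1 @^-1` A) = \int[P]_(w in C) K (X n w) A.
Proof.
move=> sC mA; rewrite (chain_markov J)//.
have mC := chain_sigma_measurable sC.
apply: ae_eq_integral => //.
- by apply: measurable_funTS; exact: (measurableT_comp (mGam mA) (mX n)).
- by apply: measurable_funTS; exact: (measurableT_comp (measurable_kernel K A mA) (mX n)).
exists (X n @^-1` degenerate); split => //; [exact: preimX|exact: law_null|].
move=> w /= H; apply: contrapT => nd; apply: H => _.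
by rewrite Gam_good.
Qed.

Let exp_lawE (B : set (\bar R)) : (fun x : borel E => exp_law (lam x) B) =
  fun x : borel E => (\1_(lam @^-1` [set 0]) x)%:E * \d_(+oo : \bar R) B +
   (\1_(lam @^-1` [set +oo%E]) x)%:E * \d_(0 : \bar R) B +
   (\1_(~` degenerate) x)%:E * Ex x (EFin @^-1` B).
Proof.
apply/funext => x; rewrite !indicE in_setC.
case: (pselect (lam x = 0)) => [l0|nl0].
  rewrite (mem_set (l0 : (lam @^-1` [set 0]) x)) (mem_set (or_introl l0 : degenerate x)).
  rewrite memNset; last by rewrite /= l0.
  by rewrite l0 /= eqxx mul1e !mul0e !adde0.
rewrite (memNset (nl0 : ~ (lam @^-1` [set 0]) x)).
case: (pselect (lam x = +oo)) => [loo|nloo].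
  rewrite (mem_set (loo : (lam @^-1` [set +oo%E]) x)) (mem_set (or_intror loo : degenerate x)).
  by rewrite loo /= mul1e !mul0e adde0 add0e.
rewrite (memNset (nloo : ~ (lam @^-1` [set +oo%E]) x)).
have nd : ~ degenerate x by case.
by rewrite (memNset nd) lam_good//= gt_eqF// !mul0e mul1e !add0e.
Qed.

Let mexp_law (B : set (\bar R)) : measurable B ->
  measurable_fun setT (fun x : borel E => exp_law (lam x) B).
Proof.
move=> mB; rewrite exp_lawE.
have mi (D : set (borel E)) : measurable D -> measurable_fun setT (fun x => (\1_D x)%:E : \bar R).
  by move=> mD; apply/measurable_EFinP; exact: measurable_indic.
have mE : measurable (EFin @^-1` B : set R).
  have mEF : measurable_fun setT (fun r : R => r%:E) by apply/measurable_EFinP.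
  by rewrite -[X in measurable X]setTI; exact: mEF.
have mlp (c : \bar R) : measurable ((lam : borel E -> _) @^-1` [set c]).
  by rewrite -[X in measurable X]setTI; exact: mlam.
apply: emeasurable_funD; first apply: emeasurable_funD.
- by apply: emeasurable_funM => //; exact: mi.
- by apply: emeasurable_funM => //; exact: mi.
- apply: emeasurable_funM; first by apply: mi; exact: measurableC.
  exact: (measurable_kernel Ex _ mE).
Qed.

(** Real-valued holding times; they differ from [tau] only where [tau] is infinite,
   which has probability zero. *)
Let sig n w : R := fine (tau n w).

Let msig n : measurable_fun setT (sig n).
Proof. exact: measurableT_comp. Qed.

Let ae_good : {ae P, forall w, forall n, ~ degenerate (X n w)}.
Proof.
apply/ae_foralln => n; exists (X n @^-1` degenerate); split => //.
- exact: preimX.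
- exact: law_null.
- by move=> w /= /contrapT.
Qed.

Let mprod_exp_law n (B : nat -> set (\bar R)) : (forall k, measurable (B k)) ->
  measurable_fun setT (fun w => \prod_(k < n) exp_law (lam (X k w)) (B k)).
Proof.
move=> mB; apply: (@emeasurable_prod_ord _ Omega _ n (fun k w => exp_law (lam (X k w)) (B k))) => k _.
exact: (measurableT_comp (mexp_law (mB k)) (mX k)).
Qed.

Let holding_regular n C (B : nat -> set R) :
  chain_sigma X setT C -> (forall k, measurable (B k)) ->
  P (C `&` \bigcap_(k < n) (sig k @^-1` B k)) =
  \int[P]_(w in C) \prod_(k < n) Ex (X k w) (B k).
Proof.
move=> sC mB; have mC := chain_sigma_measurable sC.
pose B' k : set (\bar R) := fine @^-1` B k.
have mB' k : measurable (B' k).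
  have mfine : measurable_fun [set: \bar R] (@fine R) by [].
  by rewrite -[X in measurable X]setTI; exact: mfine.
rewrite -[LHS]/(P (C `&` \bigcap_(k < n) (tau k @^-1` B' k))).
rewrite (holding_law J)//; apply: ae_eq_integral => //.
- by apply: measurable_funTS; exact: mprod_exp_law.
- apply: measurable_funTS.
  apply: (@emeasurable_prod_ord _ Omega _ n (fun k w => Ex (X k w) (B k))) => k kn.
  exact: (measurableT_comp (measurable_kernel Ex (B k) (mB k)) (mX k)).
apply: filterS ae_good => w good _; apply: eq_bigr => k _.
by rewrite lam_good//= gt_eqF.
Qed.

Let ae_finite : {ae P, forall w, forall n, tau n w \is a fin_num}.
Proof.
apply/ae_foralln => n.
pose B k : set (\bar R) := if k == n then [set +oo%E] else setT.
have mB k : measurable (B k) by rewrite /B; case: ifP.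
have H0 : P (tau n @^-1` [set +oo%E]) = 0.
  have -> : tau n @^-1` [set +oo%E] = setT `&` \bigcap_(k < n.+1) (tau k @^-1` B k).
    rewrite setTI; apply/seteqP; split => w /=.
      by move=> tn k _; rewrite /B; case: eqP => [->|].
    by move=> /(_ n (ltnSn n)); rewrite /B eqxx.
  rewrite (holding_law J)//; last exact: (@measurableT _ (g_sigma_algebraType _)).
  rewrite (_ : 0 = \int[P]_w cst 0 w); last by rewrite integral0.
  apply: ae_eq_integral => //; first exact: mprod_exp_law.
  apply: filterS ae_good => w good _; rewrite big_ord_recr/= /B eqxx lam_good//= gt_eqF//.
  rewrite [X in _ * X](_ : _ = 0) ?mule0//.
  by rewrite (_ : EFin @^-1` _ = set0) ?measure0//; apply/seteqP; split.
exists (tau n @^-1` [set +oo%E]); split => //.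
- by rewrite -[X in measurable X]setTI; exact: mtau.
- move=> w /= /negP; rewrite ge0_fin_numE ?(holding_ge0 J)// -leNgt leye_eq.
  by move/eqP.
Qed.

Let jump_time0 w : jump_time tau 0 w = 0.
Proof. by rewrite /jump_time big_ord0. Qed.

Let jump_timeS n w : jump_time tau n.+1 w = jump_time tau n w + tau n w.
Proof. by rewrite /jump_time big_ord_recr. Qed.

Let jump_time_nd w m n : (m <= n)%N -> jump_time tau m w <= jump_time tau n w.
Proof.
move=> /subnK <-; elim: (n - m)%N => [|k IH]; first by rewrite add0n.
by rewrite addSn jump_timeS (le_trans IH)// leeDl// (holding_ge0 J).
Qed.

Let mjump_time n : measurable_fun setT (jump_time tau n).
Proof. by apply: emeasurable_sum => k; exact: mtau. Qed.

Variables (A : set (borel E)) (mA : measurable A) (s : R) (s_ge0 : (0 <= s)%R).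

Let sojourn n := [set w | [/\ A (X n w), jump_time tau n w <= s%:E &
  s%:E < jump_time tau n.+1 w]].

(** A jump time equal to its successor is skipped by the supremum, as it is by the
   strict inequality on the right. *)
Let last_jump n w : jump_time tau n w <= s%:E -> s%:E < jump_time tau n.+1 w ->
  supremum 0%N [set m | jump_time tau m w <= s%:E] = n.
Proof.
move=> ns sn; rewrite /supremum ifF; last first.
  by apply/negbTE/set0P; exists n.
have sup_n : supremums [set m | jump_time tau m w <= s%:E] n.
  split; last by move=> m; apply.
  move=> m /= ms; rewrite leEnat leqNgt; apply/negP => nm.
  by have := le_lt_trans (le_trans (jump_time_nd w nm) ms) sn; rewrite ltxx.
exact: (xget_unique 0%N sup_n (fun m sm => is_subset1_supremums sm sup_n)).
Qed.

(** A time below the supremum of the jump times lies in exactly one sojourn. *)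
Let jump_state_sojourn :
  jump_state X tau s @^-1` (Some @` A) = \bigcup_n sojourn n.
Proof.
apply/seteqP; split => w /=.
  rewrite /jump_state; case: ifPn => [sup|_ [x _]//] [x Ax [xE]].
  have [_ [N _ <-] sN] := ereal_sup_gt sup.
  have exN : exists n, s%:E < jump_time tau n w by exists N.
  case: (ex_minnP exN) => -[|n] sn nmin.
    by move: sn; rewrite jump_time0 lte_fin ltNge s_ge0.
  have ns : jump_time tau n w <= s%:E.
    by rewrite leNgt; apply/negP => /nmin; rewrite ltnn.
  by exists n => //; split => //; rewrite -(last_jump ns sn) -xE.
move=> [n _ [AX ns sn]]; exists (X n w) => //.
rewrite /jump_state ifT ?(last_jump ns sn)//.
by apply: (lt_le_trans sn); apply: ereal_sup_ubound; exists n.+1.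
Qed.

Let msojourn n : measurable (sojourn n).
Proof.
rewrite (_ : sojourn n = (X n @^-1` A) `&` [set w | jump_time tau n w <= s%:E] `&`
  [set w | s%:E < jump_time tau n.+1 w]); last first.
  by apply/seteqP; split => w /=; [case|move=> [[]]].
apply: measurableI; last first.
  by rewrite -[X in measurable X]setTI; exact: emeasurable_fun_o_infty.
apply: measurableI; first exact: preimX.
by rewrite -[X in measurable X]setTI; exact: emeasurable_fun_infty_c.
Qed.

Let trivIset_sojourn : trivIset setT sojourn.
Proof.
apply/trivIsetP => m n _ _ mn; apply/seteqP; split => // w.
move=> [[_ ms sm] [_ ns sn]].
by move/eqP: mn; apply; rewrite -(last_jump ms sm) -(last_jump ns sn).
Qed.

Let prob_sojourn n : P (sojourn n) =
  P [set w | [/\ A (X n w), (arrival sig n w <= s)%R & (s < arrival sig n.+1 w)%R]].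
Proof.
have marr k : measurable_fun setT (arrival sig k) by exact: measurable_sum.
set D := [set w | _].
have mD : measurable D.
  rewrite (_ : D = (X n @^-1` A) `&` (arrival sig n @^-1` `]-oo, s]) `&`
      (arrival sig n.+1 @^-1` `]s, +oo[)); last first.
    apply/seteqP; split => w /=; rewrite !in_itv/= andbT; first by case.
    by move=> [[? ?] ?].
  apply: measurableI; last by rewrite -[X in measurable X]setTI; exact: marr.
  apply: measurableI; first exact: preimX.
  by rewrite -[X in measurable X]setTI; exact: marr.
rewrite -[sojourn n]setIT -[D]setIT -!integral_indic//.
apply: ae_eq_integral => //.
- by apply/measurable_EFinP; exact: measurable_indic.
- by apply/measurable_EFinP; exact: measurable_indic.
apply: filterS ae_finite => w fin_tau _; rewrite !indicE.
have arrE k : jump_time tau k w = (arrival sig k w)%:E.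
  rewrite /jump_time /arrival -sumEFin; apply: eq_bigr => i _.
  by rewrite fineK.
congr (nat_of_bool _)%:R%:E; apply/idP/idP; rewrite !inE /sojourn /D /= !arrE.
  by rewrite lee_fin lte_fin.
by rewrite lee_fin lte_fin.
Qed.

(** The value of the process at time [s] is [X n] on the [n]-th sojourn; sum over
    [n] the probabilities of being in [A] after exactly [n] jumps. *)
Lemma state_law_transition :
  state_law X tau P s A = \int[mu]_x transition gam q l A (s, x).
Proof.
rewrite /state_law jump_state_sojourn.
transitivity (\sum_(0 <= n <oo) P (sojourn n)).
  by apply: measure_semi_bigcup => //; exact: bigcup_measurable.
under eq_eseriesr do rewrite prob_sojourn.
rewrite (prob_state_transition mX msig markov_regular holding_regular mA).
have mV : measurable_fun setT (fun x : borel E => transition gam q l A (s, x)).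
  exact: (measurableT_comp (measurable_transition gam mq q_ge0 ml mA) (pair1_measurable s)).
have V0 x : 0 <= transition gam q l A (s, x) by exact: transition_ge0.
transitivity (\int[pushforward P (X 0%N : Omega -> borel E)]_x transition gam q l A (s, x)).
  by rewrite (ge0_integral_pushforward (mX 0%N)).
by apply: eq_measure_integral => B mB _; exact: (chain_init J mB).
Qed.

End jump_process_law.

(** * Cauchy-Schwarz bound for the total variation distance *)

Section square_integrable.
Context d (T : measurableType d) (R : realType) (P : probability T R).

Lemma integrable_mul_of_squares (u v : T -> R) :
  measurable_fun setT u -> measurable_fun setT v ->
  P.-integrable setT (EFin \o (fun x => u x ^+ 2)) ->
  P.-integrable setT (EFin \o (fun x => v x ^+ 2)) ->
  P.-integrable setT (EFin \o (fun x => u x * v x)).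
Proof.
move=> mu mv iu iv.
apply: (@le_integrable _ _ _ P _ measurableT _ (EFin \o (fun x => u x ^+ 2 + v x ^+ 2))).
- by apply/measurable_EFinP; exact: measurable_funM.
- move=> x _; rewrite /= lee_fin [leRHS]ger0_norm ?addr_ge0 ?sqr_ge0//.
  move: (u x) (v x) => a b; have := sqr_ge0 (a + b); have := sqr_ge0 (a - b).
  by have := sqr_ge0 a; have := sqr_ge0 b => *; rewrite ler_norml; apply/andP; split; nra.
- exact: (integrableD measurableT iu iv).
Qed.

(** Nonnegativity of the quadratic polynomial [c |-> \int (u + c v)^2], evaluated
    at its minimum; when [v] vanishes almost everywhere it is affine, and must be
    constant. *)
Lemma Rintegral_cauchy_schwarz (u v : T -> R) :
  measurable_fun setT u -> measurable_fun setT v ->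
  P.-integrable setT (EFin \o (fun x => u x ^+ 2)) ->
  P.-integrable setT (EFin \o (fun x => v x ^+ 2)) ->
  (\int[P]_x (u x * v x)) ^+ 2 <= (\int[P]_x (u x ^+ 2)) * (\int[P]_x (v x ^+ 2)).
Proof.
move=> mu mv iu iv.
have iuv := integrable_mul_of_squares mu mv iu iv.
set U := \int[P]_x (u x ^+ 2); set V := \int[P]_x (v x ^+ 2).
set W := \int[P]_x (u x * v x).
have U0 : 0 <= U by apply: Rintegral_ge0 => x _; exact: sqr_ge0.
have V0 : 0 <= V by apply: Rintegral_ge0 => x _; exact: sqr_ge0.
have Q (c : R) : 0 <= U + (2 * c * W + c ^+ 2 * V).
  have i1 : P.-integrable setT (EFin \o (fun x => 2 * c * (u x * v x))).
    exact: (integrableZl measurableT (2 * c) iuv).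
  have i2 : P.-integrable setT (EFin \o (fun x => c ^+ 2 * v x ^+ 2)).
    exact: (integrableZl measurableT (c ^+ 2) iv).
  have i3 : P.-integrable setT (EFin \o (fun x => 2 * c * (u x * v x) + c ^+ 2 * v x ^+ 2)).
    exact: (integrableD measurableT i1 i2).
  rewrite /U /V /W -!RintegralZl// -!RintegralD//.
  by apply: Rintegral_ge0 => x _; have := sqr_ge0 (u x + c * v x); rewrite le_eqVlt => H; nra.
have [V1|V1] := eqVneq V 0.
  have W0 : W = 0.
    apply/eqP; apply: contraT => W0.
    have := Q (- (U + 1) / (2 * W)).
    rewrite V1 mulr0 addr0 (_ : 2 * (- (U + 1) / (2 * W)) * W = - (U + 1)); last by field.
    lra.
  by rewrite W0 V1 mulr0 expr0n.
have Vpos : 0 < V by rewrite lt_def V1 V0.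
have := Q (- W / V).
rewrite (_ : U + _ = (U * V - W ^+ 2) / V); last by field.
by rewrite pmulr_lge0 ?invr_gt0// subr_ge0.
Qed.

End square_integrable.

Section total_variation.
Context (R : realType) (E : ptopologicalType).
Variables (pi mu : probability (borel E) R).
Hypothesis mu_pi : mu `<< pi.

Let h (x : borel E) : R := fine (Radon_Nikodym (charge_of_finite_measure mu) pi x).

Let hE x : (h x)%:E = Radon_Nikodym (charge_of_finite_measure mu) pi x.
Proof. by rewrite fineK// Radon_Nikodym_fin_num. Qed.

Let ih : pi.-integrable setT (EFin \o h).
Proof.
rewrite (_ : EFin \o h = Radon_Nikodym (charge_of_finite_measure mu) pi).
  exact: Radon_Nikodym_integrable.
by apply/funext => x; exact: hE.
Qed.

Let mh : measurable_fun setT h.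
Proof. by have /integrableP[/measurable_EFinP] := ih. Qed.

Let chi2E : chi2 mu pi = (\int[pi]_x ((h x - 1) ^+ 2)%:E)%E.
Proof. by apply: eq_integral => x _; rewrite -hE EFin_expe EFinB. Qed.

(** Cauchy-Schwarz applied to [(f - a) (h - 1)], with [h] the density of [mu].  The
    chi-square divergence may be infinite; the product with [B] is then infinite
    unless [B = 0], in which case [f] is [pi]-almost everywhere, hence
    [mu]-almost everywhere, equal to its mean. *)
Lemma mean_difference_le (f : borel E -> R) (a B : R) : measurable_fun setT f ->
  (forall x, 0 <= f x) -> (forall x, f x <= 1) -> \int[pi]_x f x = a ->
  \int[pi]_x (f x - a) ^+ 2 <= B ^+ 2 -> 0 <= B ->
  (`| \int[mu]_x (f x)%:E - a%:E | <= B%:E * chi2 mu pi `^ 2^-1)%E.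
Proof.
move=> mf f0 f1 fa fB B0.
have if_ : pi.-integrable setT (EFin \o f).
  apply: (@le_integrable _ _ _ pi _ measurableT _ (EFin \o cst 1)).
  - exact/measurable_EFinP.
  - by move=> x _; rewrite /= lee_fin normr1 ger0_norm.
  - exact: finite_measure_integrable_cst.
have fmu : (\int[mu]_x (f x)%:E = \int[pi]_x (f x * h x)%:E)%E.
  rewrite -(Radon_Nikodym_change_of_variables mu_pi measurableT).
    by apply: eq_integral => x _; rewrite EFinM hE.
  apply: (@le_integrable _ _ _ mu _ measurableT _ (EFin \o cst 1)).
  - exact/measurable_EFinP.
  - by move=> x _; rewrite /= lee_fin normr1 ger0_norm.
  - exact: finite_measure_integrable_cst.
have chi0 : (0 <= chi2 mu pi)%E.
  by rewrite chi2E; apply: integral_ge0 => x _; rewrite lee_fin sqr_ge0.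
have mfa : measurable_fun setT (fun x => f x - a) by exact: measurable_funB.
have ifa2 : pi.-integrable setT (EFin \o (fun x => (f x - a) ^+ 2)).
  apply: (@le_integrable _ _ _ pi _ measurableT _ (EFin \o cst ((1 + `|a|) ^+ 2))).
  - by apply/measurable_EFinP; exact: measurable_funX.
  - move=> x _; rewrite /= lee_fin (ger0_norm (sqr_ge0 (f x - a))) (ger0_norm (sqr_ge0 (1 + `|a|))) -subr_ge0 subr_sqr.
    have := ler_norm a; have := ler_norm (- a); rewrite normrN => na pa.
    by have := f0 x; have := f1 x => ? ?; rewrite mulr_ge0//; lra.
  - exact: finite_measure_integrable_cst.
(* The case [B = 0], where the right-hand side is [0] even if [chi2] is infinite. *)
have [Bz|Bnz] := eqVneq B 0.
  have I0 : (\int[pi]_x `|((f x - a) ^+ 2)%:E| = 0)%E.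
    under eq_integral do rewrite /= ger0_norm ?sqr_ge0//.
    rewrite -[LHS]fineK; last exact: (integrable_fin_num measurableT ifa2).
    congr EFin; apply/eqP; rewrite eq_le.
    rewrite (le_trans fB) ?Bz ?expr0n//=.
    by apply: (@Rintegral_ge0 _ _ _ pi) => x _; exact: sqr_ge0.
  have m2 : measurable_fun setT (fun x => ((f x - a) ^+ 2)%:E).
    by apply/measurable_EFinP; exact: measurable_funX.
  have [N [mN N0 NS]] := (ae_eq_integral_abs pi measurableT m2).1 I0.
  have muN : mu N = 0%E by have /null_content_dominatesP := mu_pi; apply.
  rewrite (_ : \int[mu]_x (f x)%:E = \int[mu]_x (cst a%:E) x)%E; last first.
    apply: ae_eq_integral => //; first exact/measurable_EFinP.
    exists N; split => // x /= nx; apply: NS => /= /(_ Logic.I) /eqP.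
    rewrite eqe sqrf_eq0 subr_eq0 => /eqP fx; apply: nx => _.
    by rewrite fx.
  rewrite integral_cst// [X in (_ * X - _)%E](@probability_setT _ _ _ mu) mule1 subee//= normr0.
  by rewrite Bz mul0e.
have [chioo|chifin] := eqVneq (chi2 mu pi) +oo%E.
  by rewrite chioo poweRyr ?invr_eq0// gt0_muley ?leey// lte_fin lt_def Bnz.
have ih1 : pi.-integrable setT (EFin \o (fun x => (h x - 1) ^+ 2)).
  apply/integrableP; split.
    by apply/measurable_EFinP; apply: measurable_funX; exact: measurable_funB.
  under eq_integral do rewrite /= ger0_norm ?sqr_ge0//.
  by rewrite -chi2E ltey.
have mh1 : measurable_fun setT (fun x => h x - 1) by exact: measurable_funB.
have ia : pi.-integrable setT (EFin \o (fun=> a)) by exact: finite_measure_integrable_cst.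
have ifa : pi.-integrable setT (EFin \o (fun x => f x - a)).
  exact: (integrableB measurableT if_ ia).
have CS := Rintegral_cauchy_schwarz mfa mh1 ifa2 ih1.
have iW := integrable_mul_of_squares mfa mh1 ifa2 ih1.
pose C := \int[pi]_x (h x - 1) ^+ 2.
have CE : chi2 mu pi = C%:E by rewrite chi2E /C /Rintegral fineK//; exact: integrable_fin_num.
have C0 : 0 <= C by apply: Rintegral_ge0 => x _; exact: sqr_ge0.
have ifh : pi.-integrable setT (EFin \o (fun x => f x * h x)).
  apply: (@le_integrable _ _ _ pi _ measurableT _ (EFin \o h)) => //.
  - by apply/measurable_EFinP; exact: measurable_funM.
  - by move=> x _; rewrite /= lee_fin normrM ger0_norm// ler_piMl.
have h1 : \int[pi]_x h x = 1.
  rewrite /Rintegral; under eq_integral do rewrite hE.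
  rewrite -(@Radon_Nikodym_integral _ _ _ (charge_of_finite_measure mu) pi setT mu_pi measurableT).
  by rewrite [X in fine X](@probability_setT _ _ _ mu).
have iah : pi.-integrable setT (EFin \o (fun x => a * h x)).
  exact: (integrableZl measurableT a ih).
have WE : \int[pi]_x (f x * h x) = \int[pi]_x ((f x - a) * (h x - 1)) + a.
  have -> : \int[pi]_x (f x * h x) = \int[pi]_x ((f x - a) * (h x - 1) + (f x + (a * h x - a))).
    by apply: eq_Rintegral => x _; ring.
  have i1 := integrableB measurableT iah ia.
  have i2 := integrableD measurableT if_ i1.
  rewrite RintegralD// RintegralD// RintegralB// fa RintegralZl// h1 Rintegral_cst//.
  by rewrite [X in a * fine X](@probability_setT _ _ _ pi)/=; ring.
rewrite fmu -[X in (`|X - _|)%E]fineK; last exact: (integrable_fin_num measurableT ifh).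
rewrite -[fine _]/(\int[pi]_x (f x * h x)) WE -EFinB addrK CE poweR_EFin -EFinM lee_fin.
rewrite powR12_sqrt// -(ger0_norm (mulr_ge0 B0 (sqrtr_ge0 C))) -ler_sqr ?nnegrE//.
rewrite !real_normK ?num_real// exprMn sqr_sqrtr//.
by apply: (le_trans CS); rewrite ler_wpM2r.
Qed.
End total_variation.

(** * Reversibility of the locally balanced rates *)

Section locally_balanced.
Context (R : realType) (E : ptopologicalType).
Variables (pi : probability (borel E) R) (gamma : R.-pker (borel E) ~> (borel E)).
Variables (t : E * E -> R) (S : set (E * E)) (t_ratio : is_ratio pi gamma t S).
Variables (g : R -> R) (g_balancing : balancing g).
Hypothesis g_nd : {in `[0, +oo[ &, {homo g : r s / r <= s}}.

Local Notation M := (pi_gamma pi gamma).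

Let swap (z : borel E * borel E) : borel E * borel E := (z.2, z.1).

Let mswap : measurable_fun setT swap.
Proof. exact: measurable_fun_pair. Qed.

Let mt : measurable_fun [set: borel E * borel E] t.
Proof. exact: ratio_measurable t_ratio. Qed.

Let t0 z : 0 <= t z.
Proof. exact: ratio_ge0 t_ratio z. Qed.

Definition balanced_density (z : borel E * borel E) : R := g (t z).
Local Notation b := balanced_density.

Lemma measurable_balanced_density : measurable_fun setT b.
Proof.
apply: (@measurable_comp _ _ _ (borel E * borel E)%type R R (`[0, +oo[%classic : set R) g setT t) => //.
- by move=> _ [z _ <-]; rewrite /= in_itv/= t0.
- exact: balancing_measurable g_balancing.
Qed.

Let mb := measurable_balanced_density.

Let b0 z : 0 <= b z.
Proof.
have := t0 z; rewrite le_eqVlt => /predU1P[tz|tz].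
  by rewrite /b -tz (balancing0 g_balancing).
by rewrite ltW// (balancing_gt0 g_balancing).
Qed.

(** Monotonicity bounds [g] by [1] on [0, 1], and the balancing identity turns this
   into [g s = s * g (1 / s) <= s] for [s >= 1]. *)
Let b_le z : b z <= 1 + t z.
Proof.
have in0 r : 0 <= r -> r \in `[0, +oo[%R by move=> r0; rewrite in_itv/= r0.
have [t1|t1] := leP (t z) 1.
  apply: (@le_trans _ _ 1); last by rewrite lerDl.
  by rewrite -[leRHS](balancing1 g_balancing) g_nd ?in0.
have tz : 0 < t z by apply: lt_trans t1.
rewrite /b (balancing_inv g_balancing tz).
apply: (@le_trans _ _ (t z)); last by rewrite lerDr.
rewrite ler_piMr// -[leRHS](balancing1 g_balancing) g_nd ?in0 ?invr_ge0//.
by rewrite invf_le1// ltW.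
Qed.

Let S_swap x y : S (x, y) -> S (y, x).
Proof.
move=> Sxy; apply: contrapT => nS.
have := ratio_sym t_ratio Sxy; rewrite (ratio_out t_ratio nS) => /eqP.
by rewrite eq_sym invr_eq0 gt_eqF// (ratio_gt0 t_ratio Sxy).
Qed.

Lemma integral_pi_gamma (f : borel E * borel E -> \bar R) :
  measurable_fun setT f -> (forall z, 0 <= f z)%E ->
  (\int[M]_z f z = \int[pi]_x \int[gamma x]_y f (x, y))%E.
Proof. exact: (@integral_semidirect _ _ _ _ R pi gamma f). Qed.

(** The defining property of [t], extended from sets to functions. *)
Let integral_swap (f : borel E * borel E -> \bar R) :
  measurable_fun setT f -> (forall z, 0 <= f z)%E ->
  (\int[M]_z f (swap z) = \int[M]_z (f z * (t z)%:E))%E.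
Proof.
move=> mf f0; have mtE : measurable_fun setT (fun z : borel E * borel E => (t z)%:E).
  exact/measurable_EFinP.
have t0E z : (0 <= (t z)%:E)%E by rewrite lee_fin.
have MA (A : set (borel E * borel E)) : measurable A ->
  (M (swap @^-1` A) = \int[M]_(z in A) (t z)%:E)%E := fun mA => ratio_density t_ratio mA.
exact: (@integral_comp_density _ _ _ _ R M M swap _ mswap mtE t0E (fun=> isT) MA f mf f0).
Qed.

(** Reversibility.  The exchange of coordinates multiplies the measure by [t], and
    [b (y, x) t (x, y) = g (1 / t (x, y)) t (x, y) = b (x, y)]. *)
Lemma balanced_symmetric (f : borel E * borel E -> \bar R) :
  measurable_fun setT f -> (forall z, 0 <= f z)%E ->
  (\int[M]_z (f (swap z) * (b z)%:E) = \int[M]_z (f z * (b z)%:E))%E.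
Proof.
move=> mf f0.
(* [b / t], written so that it is measurable, with value 0 where [t] vanishes. *)
pose r z := b z * expR (- ln (t z)).
have r0 z : 0 <= r z by rewrite mulr_ge0// expR_ge0.
have mr : measurable_fun setT r.
  apply: measurable_funM => //; apply: measurableT_comp => //.
  by apply: measurable_funN; exact: measurableT_comp.
have bt0 z : t z = 0 -> b z = 0.
  by move=> tz; rewrite /b tz (balancing0 g_balancing).
have rt z : r z * t z = b z.
  have [tz|tz] := eqVneq (t z) 0; first by rewrite tz mulr0 bt0.
  by rewrite /r expRN lnK ?posrE ?lt_def ?tz ?t0// divfK.
have rswap z : r (swap z) = b z.
  case: z => x y; rewrite /swap/=.
  case: (pselect (S (x, y))) => [Sxy|nS].
    have txy := ratio_gt0 t_ratio Sxy.
    rewrite /r /b (ratio_sym t_ratio Sxy) expRN lnK ?posrE ?invr_gt0// invrK.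
    by rewrite [RHS](balancing_inv g_balancing txy) mulrC.
  rewrite [RHS]bt0 ?(ratio_out t_ratio)//.
  have nS' : ~ S (y, x) by move=> /S_swap.
  by rewrite /r bt0 ?mul0r// (ratio_out t_ratio).
transitivity (\int[M]_z (f (swap z) * (r (swap z))%:E))%E.
  by apply: eq_integral => z _; rewrite rswap.
rewrite (integral_swap (f := fun z => f z * (r z)%:E)%E).
- by apply: eq_integral => z _; rewrite -muleA -EFinM rt.
- by apply: emeasurable_funM => //; exact/measurable_EFinP.
- by move=> z; rewrite mule_ge0// lee_fin.
Qed.

Local Notation lam := (jump_rate gamma g t).

Let lamE x : lam x = (\int[gamma x]_y (b (x, y))%:E)%E.
Proof. by []. Qed.

Let lam0 x : (0 <= lam x)%E.
Proof. by apply: integral_ge0 => y _; rewrite lee_fin; exact: b0. Qed.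

Lemma measurable_jump_rate : measurable_fun setT (lam : borel E -> \bar R).
Proof.
apply: (measurable_integral_spker gamma (f := fun z => (b z)%:E)).
  exact/measurable_EFinP.
by move=> z; rewrite lee_fin.
Qed.

Let mlam := measurable_jump_rate.

Let M1 : M setT = 1%E.
Proof.
transitivity (\int[M]_z cst 1 z)%E; first by rewrite integral_cst// mul1e.
rewrite integral_pi_gamma//.
transitivity (\int[pi]_x cst 1 x)%E.
  by apply: eq_integral => x _; rewrite integral_cst// mul1e; exact: prob_kernel.
by rewrite integral_cst// mul1e; exact: probability_setT.
Qed.

(** [b <= 1 + t], and both [1] and [t] integrate to 1. *)
Let integral_lam : (\int[pi]_x lam x <= 2%:E)%E.
Proof.
rewrite -(integral_pi_gamma (f := fun z => (b z)%:E)); last 2 first.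
- exact/measurable_EFinP.
- by move=> z; rewrite lee_fin.
apply: (@le_trans _ _ (\int[M]_z (1 + t z)%:E)%E).
  apply: ge0_le_integral => //.
  - by move=> z _; rewrite lee_fin.
  - exact/measurable_EFinP.
  - by apply/measurable_EFinP; exact: measurable_funD.
  - by move=> z _; rewrite lee_fin.
under eq_integral do rewrite EFinD.
rewrite ge0_integralD//; last 2 first.
- by move=> z _; rewrite lee_fin.
- exact/measurable_EFinP.
rewrite integral_cst// mul1e M1.
have <- : M setT = (\int[M]_z (t z)%:E)%E := ratio_density t_ratio measurableT.
rewrite M1.
by rewrite -EFinD.
Qed.

Local Notation deg := (degenerate lam).

Let mdeg : measurable deg.
Proof. exact: measurable_degenerate mlam. Qed.

Let rate_infinite_null : pi (lam @^-1` [set +oo%E]) = 0%E.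
Proof.
have lami : pi.-integrable setT (lam : borel E -> \bar R).
  apply/integrableP; split => //.
  rewrite (eq_integral (lam : borel E -> \bar R)); first exact: (le_lt_trans integral_lam (ltry _)).
  by move=> x _; rewrite gee0_abs.
apply: measure_negligible; first by rewrite -[X in measurable X]setTI; apply: mlam.
have [N [mN N0 sN]] := integrable_ae measurableT lami.
by exists N; split => // x /= lx; apply: sN => /= /(_ Logic.I); rewrite lx.
Qed.

(** If the rate vanishes at [x] then [b (x, _)] does too, almost everywhere, whereas
   [b] is positive on [S]. *)
Let rate_zero_null : pi (lam @^-1` [set 0%E]) = 0%E.
Proof.
set N0 := lam @^-1` _.
have mN0 : measurable (N0 : set (borel E)).
  by rewrite -[X in measurable X]setTI; apply: mlam.
have m1 : measurable_fun setT (fun z : borel E * borel E => \1_N0 z.1 : R).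
  by apply: measurableT_comp; [exact: measurable_indic|exact: measurable_fst].
have mf : measurable_fun setT (fun z : borel E * borel E => (\1_N0 z.1 * b z)%:E).
  by apply/measurable_EFinP; exact: measurable_funM.
have f0 z : (0 <= (\1_N0 z.1 * b z)%:E)%E by rewrite lee_fin mulr_ge0.
have int0 : (\int[M]_z `|(\1_N0 z.1 * b z)%:E| = 0)%E.
  under eq_integral do rewrite gee0_abs//.
  rewrite integral_pi_gamma//; apply: integral0_eq => x _ /=.
  have [xN|xN] := pselect (N0 x).
    under eq_integral do rewrite indicE mem_set// mul1r.
    exact: xN.
  by apply: integral0_eq => y _; rewrite indicE memNset// mul0r.
have [N [mN N_0 sN]] := (ae_eq_integral_abs M measurableT mf).1 int0.
have mC : measurable (~` S : set (borel E * borel E)).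
  by apply: measurableC; exact: ratio_set_measurable t_ratio.
have MC : M (~` S) = 0%E.
  have : (1 + M (~` S) = 1 + 0)%E.
    rewrite -[X in (X + _)%E](ratio_set_full t_ratio) adde0 -M1 -(setUCr S).
    by apply/esym; apply: measureU (ratio_set_measurable t_ratio) mC (setICr S).
  case: (M (~` S)) => [r| |]//; rewrite -!EFinD => -[r0].
  by congr EFin; lra.
have mX : measurable (N0 `*` setT : set (borel E * borel E)) by exact: measurableX.
have null : M (N0 `*` setT) = 0%E.
  apply: measure_negligible => //; exists (N `|` ~` S); split.
  - exact: measurableU.
  - exact: (null_set_setU mN mC N_0 MC).
  - move=> [x y] [/= xN _]; have [Sxy|nS] := pselect (S (x, y)); last by right.
    left; apply: sN => /= /(_ Logic.I) /eqP; rewrite eqe indicE mem_set// mul1r.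
    by rewrite gt_eqF// (balancing_gt0 g_balancing)// (ratio_gt0 t_ratio).
transitivity (\int[M]_z (\1_N0 z.1)%:E)%E.
  rewrite (integral_pi_gamma (f := fun z => (\1_N0 z.1)%:E)); last 2 first.
  - exact/measurable_EFinP.
  - by move=> z; rewrite lee_fin.
  rewrite -[X in pi X](setIT N0) -(integral_indic pi measurableT mN0).
  apply: eq_integral => x _.
  transitivity (\int[gamma x]_y cst (\1_N0 x)%:E y)%E; last by [].
  rewrite integral_cst// -[LHS]mule1; congr (_ * _)%E.
  by apply/esym; exact: prob_kernel.
rewrite -null -[X in _ = M X](setIT (N0 `*` setT)) -(integral_indic M measurableT mX).
apply: eq_integral => -[x y] _; rewrite !indicE; congr ((nat_of_bool _)%:R%:E).
by apply/idP/idP; rewrite !inE// => -[].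
Qed.

Lemma degenerate_null : pi deg = 0%E.
Proof.
have : deg = (lam @^-1` [set 0%E]) `|` (lam @^-1` [set +oo%E]) by [].
move=> ->; apply: null_set_setU => //.
- by rewrite -[X in measurable X]setTI; apply: mlam.
- by rewrite -[X in measurable X]setTI; apply: mlam.
Qed.

(** On the null set of degenerate states the rates are replaced by those of the base
    kernel run at unit rate: all rates are then positive and finite. *)
Definition regular_rate (x : borel E) : R :=
  \1_deg x + (1 - \1_deg x) * fine (lam x).

Definition regular_density (z : borel E * borel E) : R :=
  \1_deg z.1 + (1 - \1_deg z.1) * b z.

Local Notation l := regular_rate.
Local Notation q := regular_density.

Let degE x : deg x -> \1_deg x = 1 :> R.
Proof. by move=> xd; rewrite indicE mem_set. Qed.

Let ndegE x : ~ deg x -> \1_deg x = 0 :> R.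
Proof. by move=> xd; rewrite indicE memNset. Qed.

Lemma regular_density_degenerate x y : deg x -> q (x, y) = 1.
Proof. by move=> xd; rewrite /q/= degE// subrr mul0r addr0. Qed.

Lemma regular_density_good x y : ~ deg x -> q (x, y) = b (x, y).
Proof. by move=> xd; rewrite /q/= ndegE// subr0 mul1r add0r. Qed.

Lemma regular_rate_degenerate x : deg x -> l x = 1.
Proof. by move=> xd; rewrite /l/= degE// subrr mul0r addr0. Qed.

Lemma regular_rate_good x : ~ deg x -> lam x = (l x)%:E.
Proof.
move=> xd; rewrite /l/= ndegE// subr0 mul1r add0r fineK//.
by rewrite ge0_fin_numE// ltey; apply/eqP => lx; apply: xd; right.
Qed.

Lemma measurable_regular_rate : measurable_fun setT l.
Proof.
have m1 : measurable_fun setT (\1_deg : borel E -> R) by exact: measurable_indic.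
apply: measurable_funD => //; apply: measurable_funM.
  exact: measurable_funB.
exact: measurableT_comp.
Qed.

Lemma measurable_regular_density : measurable_fun setT q.
Proof.
have m1 : measurable_fun setT (fun z : borel E * borel E => \1_deg z.1 : R).
  by apply: measurableT_comp; [exact: measurable_indic|exact: measurable_fst].
apply: measurable_funD => //; apply: measurable_funM => //.
exact: measurable_funB.
Qed.

Lemma regular_density_ge0 z : 0 <= q z.
Proof.
case: z => x y; have [xd|xd] := pselect (deg x).
  by rewrite regular_density_degenerate.
by rewrite regular_density_good.
Qed.

Lemma regular_rate_gt0 x : 0 < l x.
Proof.
have [xd|xd] := pselect (deg x); first by rewrite regular_rate_degenerate.
rewrite -lte_fin -regular_rate_good// lt_def lam0 andbT.
by apply/eqP => lx; apply: xd; left.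
Qed.

Lemma regular_rateE x : (\int[gamma x]_y (q (x, y))%:E = (l x)%:E)%E.
Proof.
have [xd|xd] := pselect (deg x).
  rewrite regular_rate_degenerate//.
  under eq_integral do rewrite regular_density_degenerate//.
  transitivity (\int[gamma x]_y cst 1 y)%E; first by [].
  by rewrite integral_cst// mul1e; exact: prob_kernel.
rewrite -regular_rate_good// lamE.
by apply: eq_integral => y _; rewrite regular_density_good.
Qed.

Lemma integrable_regular_rate : pi.-integrable setT (EFin \o l).
Proof.
have ml := measurable_regular_rate.
apply/integrableP; split; first exact/measurable_EFinP.
apply: (@le_lt_trans _ _ (\int[pi]_x (1 + lam x))%E).
  apply: ge0_le_integral => //.
  - by apply: measurableT_comp => //; exact/measurable_EFinP.
  - by apply: emeasurable_funD.
  - move=> x _; rewrite /= gtr0_norm ?regular_rate_gt0//.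
    have [xd|xd] := pselect (deg x).
      by rewrite regular_rate_degenerate// leeDl.
    by rewrite -regular_rate_good// leeDr.
rewrite ge0_integralD// integral_cst// mul1e [X in (X + _)%E](@probability_setT _ _ _ pi).
by apply: lte_add_pinfty; [exact: ltry|exact: (le_lt_trans integral_lam (ltry _))].
Qed.

Let eq_integral_good (h k : borel E -> \bar R) :
  measurable_fun setT h -> measurable_fun setT k ->
  (forall x, 0 <= h x)%E -> (forall x, 0 <= k x)%E ->
  (forall x, ~ deg x -> h x = k x) -> (\int[pi]_x h x = \int[pi]_x k x)%E.
Proof.
move=> mh mk h0 k0 hk; apply: ge0_ae_eq_integral => //.
exists deg; split; [exact: mdeg|exact: degenerate_null|].
by move=> x /= hkx; apply: contrapT => xd; apply: hkx => _; exact: hk.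
Qed.

(** Stationarity of [pi], from reversibility applied to a function of the first
    coordinate alone. *)
Lemma regular_rate_invariant (f : borel E -> \bar R) :
  measurable_fun setT f -> (forall x, 0 <= f x)%E ->
  (\int[pi]_x \int[gamma x]_y ((q (x, y))%:E * f y) =
   \int[pi]_x ((l x)%:E * f x))%E.
Proof.
move=> mf f0.
have mq := measurable_regular_density; have ml := measurable_regular_rate.
have mf2 : measurable_fun setT (fun z : borel E * borel E => f z.2).
  exact: measurableT_comp.
have mf1 : measurable_fun setT (fun z : borel E * borel E => f z.1).
  exact: measurableT_comp.
have mbE : measurable_fun setT (fun z => (b z)%:E) by exact/measurable_EFinP.
have mF1 : measurable_fun setT (fun z => ((q z)%:E * f z.2)%E).
  by apply: emeasurable_funM => //; exact/measurable_EFinP.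
have F10 z : (0 <= (q z)%:E * f z.2)%E.
  by rewrite mule_ge0// lee_fin regular_density_ge0.
have mF2 : measurable_fun setT (fun z => (f z.2 * (b z)%:E)%E).
  exact: emeasurable_funM.
have F20 z : (0 <= f z.2 * (b z)%:E)%E by rewrite mule_ge0// lee_fin.
have mF3 : measurable_fun setT (fun z => (f z.1 * (b z)%:E)%E).
  exact: emeasurable_funM.
have F30 z : (0 <= f z.1 * (b z)%:E)%E by rewrite mule_ge0// lee_fin.
transitivity (\int[pi]_x \int[gamma x]_y (f y * (b (x, y))%:E))%E.
  apply: eq_integral_good.
  - exact: (measurable_integral_spker gamma mF1 F10).
  - exact: (measurable_integral_spker gamma mF2 F20).
  - by move=> x; apply: integral_ge0 => y _; exact: (F10 (x, y)).
  - by move=> x; apply: integral_ge0 => y _; exact: (F20 (x, y)).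
  - move=> x xd; apply: eq_integral => y _.
    by rewrite muleC regular_density_good.
rewrite -(integral_pi_gamma mF2 F20).
rewrite (balanced_symmetric (f := fun z => f z.1) mf1 (fun z => f0 z.1)).
rewrite (integral_pi_gamma mF3 F30).
apply: eq_integral_good.
- exact: (measurable_integral_spker gamma mF3 F30).
- by apply: emeasurable_funM => //; exact/measurable_EFinP.
- by move=> x; apply: integral_ge0 => y _; exact: (F30 (x, y)).
- by move=> x; rewrite mule_ge0// lee_fin ltW// regular_rate_gt0.
- move=> x xd.
  transitivity (\int[gamma x]_y (f x * (b (x, y))%:E))%E; first by [].
  rewrite ge0_integralZl//.
  + by rewrite -lamE regular_rate_good// muleC.
  + exact: (measurableT_comp mbE (pair1_measurable x)).
  + by move=> y _; rewrite lee_fin.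
Qed.

Lemma embedded_kernel_good x (A : set (borel E)) : ~ deg x ->
  embedded_kernel gamma g t x A = (\int[gamma x]_(y in A) (q (x, y) / l x)%:E)%E.
Proof.
move=> xd; rewrite /embedded_kernel ifF; last first.
  by apply/negbTE/negP => /orP[|] /eqP lx; apply: xd; [left|right].
apply: eq_integral => y _.
by rewrite regular_density_good// regular_rate_good.
Qed.

Lemma embedded_kernel_degenerate x (A : set (borel E)) : deg x ->
  embedded_kernel gamma g t x A = \d_(x : borel E) A.
Proof. by rewrite /embedded_kernel => -[] ->; rewrite eqxx ?orbT. Qed.

End locally_balanced.

(** * From the spectral gap to a Poincare inequality *)

Section poincare.
Context (R : realType) (E : ptopologicalType).
Variables (pi : probability (borel E) R) (gamma : R.-pker (borel E) ~> (borel E)).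
Variables (t : E * E -> R) (S : set (E * E)) (t_ratio : is_ratio pi gamma t S).
Variables (g : R -> R) (g_balancing : balancing g).
Hypothesis g_nd : {in `[0, +oo[ &, {homo g : r s / r <= s}}.

Local Notation lam := (jump_rate gamma g t).
Local Notation deg := (degenerate lam).
Local Notation l := (regular_rate gamma t g).
Local Notation q := (regular_density gamma t g).

Let mlam : measurable_fun setT (lam : borel E -> \bar R).
Proof. exact: (measurable_jump_rate t_ratio g_balancing). Qed.

Let ml : measurable_fun setT l.
Proof. exact: (measurable_regular_rate t_ratio g_balancing). Qed.

Let mq : measurable_fun setT q.
Proof. exact: (measurable_regular_density t_ratio g_balancing). Qed.

Let q0 z : 0 <= q z.
Proof. exact: (regular_density_ge0 t_ratio g_balancing). Qed.

Let l0 x : 0 < l x.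
Proof. exact: (regular_rate_gt0 t_ratio g_balancing). Qed.

Let lE x : (\int[gamma x]_y (q (x, y))%:E = (l x)%:E)%E.
Proof. exact: (regular_rateE t_ratio g_balancing). Qed.

Let il : pi.-integrable setT (EFin \o l).
Proof. exact: (integrable_regular_rate t_ratio g_balancing g_nd). Qed.

Let l_inv (f : borel E -> \bar R) : measurable_fun setT f ->
  (forall x, 0 <= f x)%E ->
  (\int[pi]_x \int[gamma x]_y ((q (x, y))%:E * f y) =
   \int[pi]_x ((l x)%:E * f x))%E.
Proof. exact: (regular_rate_invariant t_ratio g_balancing g_nd). Qed.

Section bounded.
Variable f : borel E -> R.
Hypothesis mf : measurable_fun setT f.
Hypothesis f0 : forall x, 0 <= f x.
Hypothesis f1 : forall x, f x <= 1.

Local Notation L x := (\int[gamma x]_y (q (x, y) * f y) - l x * f x).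

Let mqx x : measurable_fun setT (fun y => q (x, y)).
Proof. exact: (measurableT_comp mq (pair1_measurable x)). Qed.

Let iq x : (gamma x).-integrable setT (fun y => (q (x, y))%:E).
Proof.
apply/integrableP; split; first exact/measurable_EFinP.
under eq_integral do rewrite gee0_abs ?lee_fin//.
by rewrite lE ltry.
Qed.

Let iqf x : (gamma x).-integrable setT (fun y => (q (x, y) * f y)%:E).
Proof.
apply: le_integrable (iq x) => //.
- by apply/measurable_EFinP; exact: measurable_funM.
- by move=> y _; rewrite /= lee_fin !ger0_norm ?mulr_ge0// ler_piMr.
Qed.

Let weak_generator_good x : ~ deg x -> weak_generator gamma g t f x = L x.
Proof.
move=> xd; rewrite /weak_generator.
transitivity (\int[gamma x]_y (q (x, y) * f y - f x * q (x, y))).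
  apply: eq_Rintegral => y _; rewrite regular_density_good//.
  by rewrite mulrBr [f x * _]mulrC.
rewrite RintegralB//; last first.
  by under [X in _.-integrable _ X]eq_fun do rewrite EFinM; exact: integrableZl.
rewrite RintegralZl//; congr (_ - _); rewrite mulrC; congr (_ * _).
by rewrite /Rintegral lE.
Qed.

Let mQ : measurable_fun setT (fun x : borel E => \int[gamma x]_y (q (x, y) * f y)).
Proof.
apply: (measurableT_comp (f := fine)) => //.
apply: (measurable_integral_spker gamma (f := fun z => (q z * f z.2)%:E)).
  by apply/measurable_EFinP; apply: measurable_funM => //; exact: measurableT_comp.
by move=> z; rewrite lee_fin mulr_ge0.
Qed.

Let mL : measurable_fun setT (fun x : borel E => L x).
Proof. by apply: measurable_funB; last exact: measurable_funM. Qed.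

Let iL : pi.-integrable setT (EFin \o (fun x : borel E => L x)).
Proof.
have l_int (h : borel E -> R) : measurable_fun setT h -> (forall x, 0 <= h x) ->
    (forall x, h x <= l x) -> pi.-integrable setT (EFin \o h).
  move=> mh h0 hl; apply: le_integrable il => //; first exact/measurable_EFinP.
  by move=> x _; rewrite /= lee_fin !ger0_norm// ltW.
have iQ : pi.-integrable setT
    (EFin \o (fun x : borel E => \int[gamma x]_y (q (x, y) * f y))).
  apply: l_int.
  - exact: mQ.
  - by move=> x; apply: Rintegral_ge0 => y _; rewrite mulr_ge0.
  - move=> x; rewrite -[leRHS]/(fine (l x)%:E) -lE.
    by apply: le_Rintegral => // y _; rewrite ler_piMr.
have ilf : pi.-integrable setT (EFin \o (fun x => l x * f x)).
  apply: l_int => [|x|x].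
  - exact: measurable_funM.
  - by rewrite mulr_ge0// ltW.
  - by rewrite ler_piMr// ltW.
exact: (integrableB measurableT iQ ilf).
Qed.

(** The integrals of the positive and of the negative part are measurable separately;
   this covers the degenerate states, where the integral may be meaningless. *)
Let m_weak_generator : measurable_fun setT (weak_generator gamma g t f : borel E -> R).
Proof.
pose h (z : borel E * borel E) := (g (t z) * (f z.2 - f z.1))%:E.
have mh : measurable_fun setT h.
  apply/measurable_EFinP; apply: measurable_funM.
    exact: (measurable_balanced_density t_ratio g_balancing).
  by apply: measurable_funB; exact: measurableT_comp.
rewrite (_ : weak_generator gamma g t f = fun x : borel E => fine
  (\int[gamma x]_y (h^\+ (x, y))%E - \int[gamma x]_y (h^\- (x, y))%E)%E).
  apply: measurableT_comp => //; apply: emeasurable_funB.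
    apply: (measurable_integral_spker gamma (f := h^\+%E)) => //.
    exact: measurable_funepos.
  apply: (measurable_integral_spker gamma (f := h^\-%E)) => //.
  exact: measurable_funeneg.
apply/funext => x; rewrite /weak_generator /Rintegral integralE; congr (fine (_ - _)%E).
  by apply: eq_integral => y _; rewrite !funeposE.
by apply: eq_integral => y _; rewrite !funenegE.
Qed.

Lemma dirichlet_formE : dirichlet_form pi gamma g t f = - \int[pi]_x (f x * L x).
Proof.
congr (- _); rewrite /Rintegral; congr fine; apply: ae_eq_integral => //.
- by apply/measurable_EFinP; exact: measurable_funM.
- by apply/measurable_EFinP; exact: measurable_funM.
exists deg; split.
- exact: (measurable_degenerate mlam).
- exact: (degenerate_null t_ratio g_balancing g_nd).
- move=> x /= Nx; apply: contrapT => xd; apply: Nx => _.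
  by rewrite weak_generator_good.
Qed.

Local Notation m := (\int[pi]_x f x).

Let ifp : pi.-integrable setT (EFin \o f).
Proof.
apply: (@le_integrable _ _ _ pi _ measurableT _ (EFin \o cst 1)).
- exact/measurable_EFinP.
- by move=> x _; rewrite /= lee_fin normr1 ger0_norm.
- exact: finite_measure_integrable_cst.
Qed.

Let if2 : pi.-integrable setT (EFin \o (fun x => f x ^+ 2)).
Proof.
apply: (@le_integrable _ _ _ pi _ measurableT _ (EFin \o cst 1)).
- by apply/measurable_EFinP; exact: measurable_funX.
- by move=> x _; rewrite /= lee_fin normr1 ger0_norm ?sqr_ge0// exprn_ile1.
- exact: finite_measure_integrable_cst.
Qed.

Let ivar : pi.-integrable setT (EFin \o (fun x => (f x - m) ^+ 2)).
Proof.
have m0 : 0 <= m by apply: Rintegral_ge0.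
have m1 : m <= 1.
  rewrite -[leRHS](_ : \int[pi]_x cst 1 x = 1).
    apply: le_Rintegral => //; exact: finite_measure_integrable_cst.
  by rewrite Rintegral_cst// [X in fine X](@probability_setT _ _ _ pi) mulr1.
apply: (@le_integrable _ _ _ pi _ measurableT _ (EFin \o cst 1)).
- by apply/measurable_EFinP; apply: measurable_funX; exact: measurable_funB.
- move=> x _; rewrite /= lee_fin normr1 ger0_norm ?sqr_ge0//.
  by move: m0 m1 (f0 x) (f1 x); move: m (f x) => u v ? ? ? ?; nra.
- exact: finite_measure_integrable_cst.
Qed.

Lemma variance_Rintegral : ('V_pi[f] = (\int[pi]_x (f x - m) ^+ 2)%:E)%E.
Proof.
have Em : fine ('E_pi[f])%E = m by rewrite unlock.
rewrite [in RHS]/Rintegral fineK; last exact: (integrable_fin_num measurableT ivar).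
by rewrite /variance [in LHS]unlock Em unlock; apply: eq_integral => x _.
Qed.

Lemma variance_sqr : \int[pi]_x (f x - m) ^+ 2 = \int[pi]_x (f x ^+ 2) - m ^+ 2.
Proof.
transitivity (\int[pi]_x (f x ^+ 2 - (2 * m * f x - m ^+ 2))).
  by apply: eq_Rintegral => x _; ring.
have ia : pi.-integrable setT (EFin \o (fun x => 2 * m * f x)).
  by under [X in _.-integrable _ X]eq_fun do rewrite EFinM; exact: integrableZl.
have ic : pi.-integrable setT (EFin \o (fun=> m ^+ 2)).
  exact: finite_measure_integrable_cst.
rewrite RintegralB//; last exact: (integrableB measurableT ia ic).
rewrite RintegralB// RintegralZl// Rintegral_cst//.
rewrite [X in fine X](@probability_setT _ _ _ pi) mulr1.
by move: m => u; ring.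
Qed.

Let bounded_f : bounded_measurable (f : E -> R).
Proof.
split => //; exists 1; split; first exact: num_real.
by move=> M M1 x _; rewrite /= ger0_norm// (le_trans (f1 x))// ltW.
Qed.

(** Functions of positive variance compete in the infimum.  For a function that is
    constant almost everywhere the right-hand side is a multiple of the integral of
    the generator, which vanishes. *)
Lemma spectral_gap_poincare (c : R) : (c%:E <= spectral_gap pi gamma g t)%E ->
  c * (\int[pi]_x (f x ^+ 2) - m ^+ 2) <= - \int[pi]_x (f x * L x).
Proof.
move=> cgap; rewrite -variance_sqr.
set v := \int[pi]_x (f x - m) ^+ 2.
have v0 : 0 <= v by apply: Rintegral_ge0 => x _; exact: sqr_ge0.
move: (v0); rewrite le_eqVlt => /predU1P[vE|v_gt0].
  have fm : ae_eq pi setT (fun x => ((f x - m) ^+ 2)%:E) (cst 0%E).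
    apply/(ae_eq_integral_abs pi measurableT).
      by apply/measurable_EFinP; apply: measurable_funX; exact: measurable_funB.
    under eq_integral do rewrite gee0_abs ?lee_fin ?sqr_ge0//.
    by rewrite -[LHS]fineK ?integrable_fin_num// -/(Rintegral _ _ _) -/v -vE.
  rewrite -vE mulr0 (_ : \int[pi]_x (f x * L x) = m * \int[pi]_x L x).
    by rewrite (integral_generator mq q0 ml l0 lE il l_inv mf f0 f1) mulr0 oppr0.
  rewrite -(RintegralZl m measurableT iL).
  rewrite /Rintegral; congr fine; apply: ae_eq_integral => //.
  - by apply/measurable_EFinP; exact: measurable_funM.
  - by apply/measurable_EFinP; exact: measurable_funM.
  - apply: filterS fm => x /(_ Logic.I) /= [] /eqP.
    by rewrite sqrf_eq0 subr_eq0 => /eqP ->.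
rewrite -dirichlet_formE -ler_pdivlMr// -lee_fin (le_trans cgap)//.
apply: ereal_inf_lbound; exists f; last by rewrite variance_Rintegral.
by split => //; rewrite variance_Rintegral lte_fin.
Qed.

(** The infimum is infinite only when no function competes. *)
Lemma variance_eq0_infinite_gap : spectral_gap pi gamma g t = +oo%E ->
  \int[pi]_x (f x - m) ^+ 2 = 0.
Proof.
move=> gapE; apply/eqP; rewrite eq_le; apply/andP; split; last first.
  by apply: Rintegral_ge0 => x _; exact: sqr_ge0.
rewrite leNgt; apply/negP => v_gt0.
have : (spectral_gap pi gamma g t <= (dirichlet_form pi gamma g t f / fine 'V_pi[f])%:E)%E.
  apply: ereal_inf_lbound; exists f => //.
  by split => //; rewrite variance_Rintegral lte_fin.
by rewrite gapE leNgt ltry.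
Qed.

End bounded.
End poincare.

(** * Convergence of the locally balanced jump process *)

Section conclusion.
Context (R : realType) (E : ptopologicalType).
Variables (pi : probability (borel E) R) (gamma : R.-pker (borel E) ~> (borel E)).
Variables (t : E * E -> R) (S : set (E * E)) (t_ratio : is_ratio pi gamma t S).
Variables (g : R -> R) (g_balancing : balancing g).
Hypothesis g_nd : {in `[0, +oo[ &, {homo g : r s / r <= s}}.
Context d (Omega : measurableType d) (P : probability Omega R).
Variables (X : nat -> Omega -> E) (tau : nat -> Omega -> \bar R).
Variable (mu : probability (borel E) R).
Hypothesis mu_pi : mu `<< pi.
Hypothesis J : is_jump_process X tau (jump_rate gamma g t)
     (embedded_kernel gamma g t) mu P.

Local Notation lam := (jump_rate gamma g t).
Local Notation l := (regular_rate gamma t g).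
Local Notation q := (regular_density gamma t g).

Let mlam := measurable_jump_rate t_ratio g_balancing.
Let ml := measurable_regular_rate t_ratio g_balancing.
Let mq := measurable_regular_density t_ratio g_balancing.
Let q0 := regular_density_ge0 t_ratio g_balancing.
Let l0 := regular_rate_gt0 t_ratio g_balancing.
Let lE := regular_rateE t_ratio g_balancing.
Let il := integrable_regular_rate t_ratio g_balancing g_nd.
Let l_inv := regular_rate_invariant t_ratio g_balancing g_nd.

Variables (A : set (borel E)) (mA : measurable A) (s : R) (s0 : 0 <= s).

Local Notation PA := (transition_prob gamma q l A s).
Local Notation a := (fine (pi A)).

Lemma state_law_transition_prob : state_law X tau P s A = (\int[mu]_x (PA x)%:E)%E.
Proof.
rewrite (state_law_transition mq q0 ml l0 lE l_inv mlam
  (fun x => regular_rate_good t_ratio g_balancing (x := x))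
  (fun x B xd => embedded_kernel_good t_ratio g_balancing B xd)
  (fun x B xd => embedded_kernel_degenerate B xd)
  (degenerate_null t_ratio g_balancing g_nd) mu_pi J mA s0).
by apply: eq_integral => x _; rewrite transition_probE.
Qed.

Lemma state_law_le (B : R) : 0 <= B -> \int[pi]_x (PA x - a) ^+ 2 <= B ^+ 2 ->
  (`|state_law X tau P s A - pi A| <= B%:E * chi2 mu pi `^ 2^-1)%E.
Proof.
move=> B0 PB; rewrite state_law_transition_prob.
have -> : pi A = a%:E by rewrite fineK// fin_num_measure.
apply: (mean_difference_le mu_pi) => //.
- exact: measurable_transition_prob.
- by move=> x; exact: transition_prob_ge0.
- by move=> x; exact: transition_prob_le1.
- exact: (mean_transition mq q0 ml l0 lE il l_inv mA).
Qed.

(** For a finite gap the bound comes from the decay of the variance and from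
    [a - a ^ 2 <= 1 / 4].  If the gap is infinite, all variances vanish and the state
    law is exactly [pi]. *)
Lemma state_law_decay : (0 < spectral_gap pi gamma g t)%E ->
  (`|state_law X tau P s A - pi A| <= (2^-1)%:E * chi2 mu pi `^ 2^-1 *
   expeR (- (spectral_gap pi gamma g t * s%:E)))%E.
Proof.
move=> gap_gt0.
have mP : measurable_fun setT PA by exact: measurable_transition_prob.
have P0 x : 0 <= PA x by exact: transition_prob_ge0.
have P1 x : PA x <= 1 by exact: transition_prob_le1.
case gapE : (spectral_gap pi gamma g t) gap_gt0 => [c| |]// c0.
- rewrite (_ : expeR _ = (expR (- (c * s)))%:E)// muleAC -EFinM.
  apply: state_law_le.
    by rewrite mulr_ge0 ?invr_ge0// expR_ge0.
  have cgap : (c%:E <= spectral_gap pi gamma g t)%E by rewrite gapE.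
  have PI f (mf : measurable_fun setT f) f0 f1 :=
    spectral_gap_poincare t_ratio g_balancing g_nd mf f0 f1 cgap.
  apply: (le_trans (variance_decay mq q0 ml l0 lE il l_inv mA PI s0)).
  have -> : expR (- (2 * c * s)) = expR (- (c * s)) ^+ 2.
    by rewrite -expRM_natl; congr expR; ring.
  rewrite exprMn [leRHS]mulrC ler_wpM2l ?sqr_ge0//.
  rewrite -subr_ge0 (_ : _ - _ = (2^-1 - a) ^+ 2) ?sqr_ge0//.
  by move: a => u; field.
- apply: (@le_trans _ _ (0%:E * chi2 mu pi `^ 2^-1)%E).
    apply: state_law_le => //.
    rewrite -(mean_transition mq q0 ml l0 lE il l_inv mA s0).
    by rewrite (variance_eq0_infinite_gap mP P0 P1 gapE) ?expr0n.
  by rewrite mul0e !mule_ge0// ?poweR_ge0// expeR_ge0.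
Qed.

End conclusion.

Theorem proposition3p1
  (R : realType) (E : ptopologicalType) (E_polish : polish R E)
  (pi : probability (borel E) R)
  (gamma : R.-pker (borel E) ~> (borel E))
  (t : E * E -> R) (S : set (E * E)) (t_ratio : is_ratio pi gamma t S)
  (g : R -> R) (g_balancing : balancing g)
  (d : measure_display) (Omega : measurableType d)
  (X : nat -> Omega -> E) (tau : nat -> Omega -> \bar R)
  (* Px x is the law of the process started from x *)
  (Px : E -> probability Omega R)
  (Px_lbmjp : forall x, supp pi x ->
     is_jump_process X tau (jump_rate gamma g t) (embedded_kernel gamma g t)
       (\d_(x : borel E)) (Px x))
  (rate_gt0 : forall x, supp pi x -> (0 < jump_rate gamma g t x)%E)
  (g_nondecreasing : {in `[0, +oo[ &, {homo g : r s / r <= s}})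
  (g_continuous : {within `[0, +oo[, continuous g})
  (phi : {measure set (borel E) -> \bar R})
  (phi_nontrivial : phi setT <> 0%E)
  (phi_irreducible : forall x, supp pi x ->
     forall B : set (borel E), measurable B -> (0 < phi B)%E ->
     exists n : nat, (0 < Px x (X n @^-1` B))%E)
  (embedded_null : forall x, supp pi x ->
     forall A : set (borel E), measurable A -> pi A = 0%E ->
     embedded_kernel gamma g t x A = 0%E)
  (gap_gt0 : (0 < spectral_gap pi gamma g t)%E)
  (mu : probability (borel E) R) (mu_pi : mu `<< pi)
  (* the process with initial law mu *)
  (Pmu : probability Omega R)
  (Pmu_lbmjp : is_jump_process X tau (jump_rate gamma g t)
     (embedded_kernel gamma g t) mu Pmu) :
  forall s : R, 0 <= s ->
  (tv_dist (state_law X tau Pmu s) pi <=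
   (2^-1)%:E * chi2 mu pi `^ 2^-1 *
   expeR (- (spectral_gap pi gamma g t * s%:E)))%E.
Proof.
move=> s s0; apply: ge_ereal_sup => _ [A mA <-].
exact: (state_law_decay t_ratio g_balancing g_nondecreasing mu_pi Pmu_lbmjp mA s0 gap_gt0).
Qed.
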